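(* Let $g\ge2$ and $a_1,\dots,a_{g-1}\in\mathbb{R}$ with $1<a_1<a_2<\cdots<a_{g-1}$. Let $X$ be the algebraic curve defined by $w^2=z(z^2-1)(z^2-a_1^2)\cdots(z^2-a_{g-1}^2)$, and let $\Pi$ be the period matrix of $X$ for the symplectic basis $\{\alpha_1,\dots,\alpha_g,\gamma_1,\dots,\gamma_g\}$ of $H_1(X,\mathbb{Z})$ described in the context. Then $$\Pi=i\,\Pi_0^{-1}M\Pi_0N,$$ where $\Pi_0=[I_{j,k}]_{1\le j,k\le g}$ is the matrix of real integrals defined in the context, $M=[(-1)^{j-1}\delta_{j,k}]_{1\le j,k\le g}$, and $N=[N_{j,k}]_{1\le j,k\le g}$ is given by $N_{j,k}=(-1)^{g+1-j-k}$ if $j+k\le g+1$ and $N_{j,k}=0$ if $j+k>g+1$. In particular, $\mathrm{Re}(\Pi)=O$ and $\det(\Pi)=i^g$.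
   Context: The algebraic curve means the compact Riemann surface of genus $g$ of the affine curve $w^2=f(z)$, $f(z)=z(z^2-1)(z^2-a_1^2)\cdots(z^2-a_{g-1}^2)$. Put $a_{-1}=0$, $a_0=1$. Integrals. For $1\le j,k\le g$, $$I_{j,k}=(-1)^{j-1}\int_{a_{g-2k}}^{a_{g-2k+1}}\frac{z^{j-1}dz}{\sqrt{|f(z)|}}\ \text{ if } 1\le k\le\tfrac{g+1}{2},\qquad I_{j,k}=\int_{a_{2k-g-3}}^{a_{2k-g-2}}\frac{z^{j-1}dz}{\sqrt{|f(z)|}}\ \text{ if } \tfrac{g+1}{2}<k\le g.$$ Period matrix. A basis $\{\alpha_1,\dots,\alpha_g,\gamma_1,\dots,\gamma_g\}$ of $H_1(X,\mathbb{Z})$ is symplectic if the intersection numbers satisfy $i(\alpha_j,\alpha_k)=i(\gamma_j,\gamma_k)=0$ and $i(\alpha_j,\gamma_k)=\delta_{j,k}$. For a basis $\omega_1,\dots,\omega_g$ of holomorphic $1$-forms, put $A=[\int_{\alpha_k}\omega_j]_{j,k}$ and $C=[\int_{\gamma_k}\omega_j]_{j,k}$ (row index $j$, column index $k$); the period matrix is $\Pi=A^{-1}C$, independent of the choice of the $\omega_j$. Polygon. All rectangles are closed with horizontal and vertical sides in $\mathbb{C}$. Let $P_0,\dots,P_{g-1}$ be rectangles, $P_0$ a square, such that: if $g$ is even, then for $0\le i\le\frac{g-2}{2}$, $P_{2i}$ and $P_{2i+1}$ share a full common vertical side with $P_{2i}$ on the left, and for $1\le i\le\frac{g-2}{2}$,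 $P_{2i-1}$ and $P_{2i}$ share a full common horizontal side with $P_{2i-1}$ below; if $g$ is odd, then for $0\le i\le\frac{g-3}{2}$, $P_{2i}$ and $P_{2i+1}$ share a full common horizontal side with $P_{2i}$ below, and for $1\le i\le\frac{g-1}{2}$, $P_{2i-1}$ and $P_{2i}$ share a full common vertical side with $P_{2i-1}$ on the left. Let $r_l$ be the reflection about the line through the upper left and lower right vertices of $P_0$, $Q_i=r_l(P_i)$, and $P=P_0\cup\bigcup_{i=1}^{g-1}(P_i\cup Q_i)$. In the chain $Q_{g-1},\dots,Q_1,P_0,P_1,\dots,P_{g-1}$ consecutive rectangles share a side; rows (resp. columns) are maximal sets of rectangles consecutively adjacent along vertical (resp. horizontal) sides. There are $g$ rows and $g$ columns. Glue by translation, in each row, the left side of the leftmost rectangle to the right side of the rightmost one, and in each column, the bottom side of the lowest rectangle to the top side of the highest one. The result is a compact Riemann surface with holomorphic $1$-form $d\zeta$, $\zeta$ being the coordinate of the plane containing $P$. Identification. For each such $a_1,\dots,a_{g-1}$ the rectangles can be, and are, chosen so that this surface is biholomorphic to $X$, in such a way that the center of $P_0$ corresponds to $(0,0)$, the center of $P_j$ to $(a_{j-1},0)$ and the center of $Q_j$ to $(-a_{j-1},0)$ for $1\le j\le g-1$, the midpoint of the upper side of $P_{g-1}$ to $(a_{g-1},0)$, the midpoint of the left side of $Q_{g-1}$ to $(-a_{g-1},0)$, and $d\zeta=c\,\frac{dz}{w}$ with $c>0$. Basis. $\alpha_1,\dots,\alpha_g$ are the simple closed curves formed by the horizontal segments through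 the centers of the rectangles, one in each row, numbered from bottom to top and oriented from left to right. $\beta_1,\dots,\beta_g$ are the simple closed curves formed by the vertical segments through the centers, one in each column, numbered from left to right and oriented upward. $\gamma_j=\sum_{k=j}^g(-1)^{k-j}\beta_k$ in $H_1(X,\mathbb{Z})$. Then $\{\alpha_1,\dots,\alpha_g,\gamma_1,\dots,\gamma_g\}$ is a symplectic basis. *)

(* Defs.v *)
From HB Require Import structures.
From mathcomp Require Import all_boot all_order all_algebra complex zify ring lra.
From mathcomp Require Import all_classical all_reals all_analysis.
Set Implicit Arguments.
Unset Strict Implicit.
Unset Printing Implicit Defensive.
Import Order.TTheory GRing.Theory Num.Theory numFieldNormedType.Exports.
Local Open Scope classical_set_scope.
Local Open Scope complex_scope.
Local Open Scope ring_scope.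

(* The type R[i] carries no topology of its own; as a numClosedFieldType it
   inherits the normed-module structure over itself, for which [derivable _ t 1]
   and [derive1] are complex differentiability and the complex derivative. *)
Definition Cplx (R : realType) : numClosedFieldType := R[i].

Definition reC (R : realType) (z : Cplx R) : R := complex.Re z.
Definition imC (R : realType) (z : Cplx R) : R := complex.Im z.
Definition mkC (R : realType) (x y : R) : Cplx R := x +i* y.
Definition toC (R : realType) (x : R) : Cplx R := x%:C.

Section PlaneCurve.
Variable R : realType.
Local Notation C := (Cplx R).
Implicit Types (h : {poly C}) (p v u : C * C).

Definition plane_curve h : set (C * C) := [set p | p.2 ^+ 2 = h.[p.1]].

(* The tangent line at p is the kernel of 2 v dv - h'(u) du. *)
Definition tangent h p v : Prop := (p.2 * v.2) *+ 2 = h^`().[p.1] * v.1.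

(* A covector u stands for u.1 du + u.2 dv. *)
Definition pairing u v : C := u.1 * v.1 + u.2 * v.2.

(* Inverse q : D -> curve of a local coordinate, the coordinate being u or v;
   when h is squarefree, every point of the curve is in the image of such a q
   by the implicit function theorem. *)
Definition local_param h (D : set C) (q : C -> C * C) : Prop :=
  [/\ open D,
      forall t, D t -> plane_curve h (q t),
      forall t, D t -> derivable (fst \o q) t 1 /\ derivable (snd \o q) t 1
    & (forall t, D t -> (q t).1 = t) \/ (forall t, D t -> (q t).2 = t)].

(* The coefficient of the form in each local coordinate is holomorphic. *)
Definition holomorphic_covector h (eta : C * C -> C * C) : Prop :=
  forall D q, local_param h D q -> forall t, D t ->
    derivable (fun s : C => pairing (eta (q s))
                   (derive1 (fst \o q) s, derive1 (snd \o q) s)) t 1.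

(* The form du / v, which is also 2 dv / h'(u). *)
Definition du_over_v h p : C * C :=
  if p.2 == 0 then (0, 2 / h^`().[p.1]) else (p.2^-1, 0).

End PlaneCurve.

Section Curve.
Variables (R : realType) (g : nat) (a : nat -> R).
Local Notation C := (Cplx R).

(* [bp m] is a_(m-1): the indices are shifted so that a_(-1) = 0 and a_0 = 1
   are covered; only a 1, ..., a (g - 1) are ever used. *)
Definition bp (m : nat) : R :=
  match m with 0 => 0 | 1 => 1 | m'.+2 => a m'.+1 end.

Definition curve_poly : {poly R} :=
  'X * ('X^2 - 1) * \prod_(1 <= j < g) ('X^2 - (a j ^+ 2)%:P).

(* x^(2g+2) f(1/x) *)
Definition curve_poly_inf : {poly R} :=
  'X * (1 - 'X^2) * \prod_(1 <= j < g) (1 - (a j ^+ 2) *: 'X^2).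

Definition fz : {poly C} := map_poly (@toC R) curve_poly.
Definition fx : {poly C} := map_poly (@toC R) curve_poly_inf.

(* X is obtained from the smooth affine curves w^2 = fz(z) and y^2 = fx(x) by
   gluing along x = 1/z, y = w/z^(g+1).  The second one adds only the point
   (x, y) = (0, 0), denoted None.  As the first one is closed in C * C, X has
   the subspace topology of the one-point compactification of C * C. *)
Local Notation Xpt := (one_point_compactification (C * C)).

Definition surface : set Xpt :=
  [set x | if x is Some p then plane_curve fz p else True].

Definition coord_z (x : Xpt) : C := if x is Some p then p.1 else 0.
Definition coord_w (x : Xpt) : C := if x is Some p then p.2 else 0.
Definition coord_x (x : Xpt) : C := if x is Some p then p.1^-1 else 0.
Definition coord_y (x : Xpt) : C :=
  if x is Some p then p.2 / p.1 ^+ g.+1 else 0.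

(* Holomorphy of a map into X, the coordinates being (z, w) at affine points
   and (x, y) at infinity. *)
Definition holomorphic_at (phi : C -> Xpt) (t : C) : Prop :=
  {for t, continuous phi} /\
  if phi t is Some _
  then derivable (coord_z \o phi) t 1 /\ derivable (coord_w \o phi) t 1
  else derivable (coord_x \o phi) t 1 /\ derivable (coord_y \o phi) t 1.

(* A 1-form on X, written in (z, w) and in (x, y). *)
Record oneform := OneForm {
  form_zw : C * C -> C * C ;
  form_xy : C * C -> C * C }.

(* Both expressions agree under x = 1/z, y = w/z^(g+1). *)
Definition compatible (om : oneform) : Prop :=
  forall p v : C * C, plane_curve fz p -> tangent fz p v -> p.1 != 0 ->
    pairing (form_zw om p) v =
    pairing (form_xy om (p.1^-1, p.2 / p.1 ^+ g.+1))
            (- v.1 / p.1 ^+ 2,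
             v.2 / p.1 ^+ g.+1 - g.+1%:R * p.2 * v.1 / p.1 ^+ g.+2).

Definition holomorphic_form (om : oneform) : Prop :=
  [/\ compatible om,
      holomorphic_covector fz (form_zw om)
    & holomorphic_covector fx (form_xy om)].

Definition form_is_lincomb n (om : 'I_n -> oneform) (c : 'rV[C]_n)
    (th : oneform) : Prop :=
  (forall p v, plane_curve fz p -> tangent fz p v ->
     pairing (form_zw th p) v =
       \sum_j c 0 j * pairing (form_zw (om j) p) v) /\
  (forall p v, plane_curve fx p -> tangent fx p v ->
     pairing (form_xy th p) v =
       \sum_j c 0 j * pairing (form_xy (om j) p) v).

Definition holomorphic_basis n (om : 'I_n -> oneform) : Prop :=
  (forall j, holomorphic_form (om j)) /\
  (forall th, holomorphic_form th ->
     exists! c : 'rV[C]_n, form_is_lincomb om c th).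

(* dz / w = - x^(g-1) dx / y *)
Definition dz_over_w : oneform :=
  OneForm (du_over_v fz)
          (fun p => let u := du_over_v fx p in
             (- p.1 ^+ g.-1 * u.1, - p.1 ^+ g.-1 * u.2)).

(* Coefficient at t of the pullback of om by phi : T -> X; D is the derivation
   of C-valued functions on T (complex for T = C, real for T = R). *)
Definition pull (T : Type) (D : (T -> C) -> T -> C) (om : oneform)
    (phi : T -> Xpt) (t : T) : C :=
  if phi t is Some p
  then pairing (form_zw om p) (D (coord_z \o phi) t, D (coord_w \o phi) t)
  else pairing (form_xy om (0, 0))
               (D (coord_x \o phi) t, D (coord_y \o phi) t).

Definition real_derive (u : R -> C) (t : R) : C :=
  mkC (derive1 (@reC R \o u : R -> R) t) (derive1 (@imC R \o u : R -> R) t).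

Definition cintegral (s t : R) (u : R -> C) : C :=
  mkC (\int[lebesgue_measure]_(x in `[s, t]) reC (u x))%R
      (\int[lebesgue_measure]_(x in `[s, t]) imC (u x))%R.

Record path := Path { path_start : R ; path_end : R ; path_map : R -> Xpt }.

Definition path_integral (om : oneform) (ga : path) : C :=
  cintegral (path_start ga) (path_end ga) (pull real_derive om (path_map ga)).

(* Integer combinations of closed curves, representing classes in H_1(X, Z). *)
Definition cycle := seq (int * path).

Definition cycle_integral (om : oneform) (s : cycle) : C :=
  \sum_(x <- s) (x.1)%:~R * path_integral om x.2.

Definition period_mx n (om : 'I_n -> oneform) (s : nat -> cycle) : 'M[C]_n :=
  \matrix_(j, k) cycle_integral (om j) (s k).

Record rect := Rect { xl : R ; xr : R ; yb : R ; yt : R }.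

Definition nondegenerate (A : rect) : Prop := xl A < xr A /\ yb A < yt A.
Definition is_square (A : rect) : Prop := xr A - xl A = yt A - yb A.

Definition rect_set (A : rect) : set C :=
  [set t | xl A <= reC t <= xr A /\ yb A <= imC t <= yt A].

Definition xmid (A : rect) : R := (xl A + xr A) / 2.
Definition ymid (A : rect) : R := (yb A + yt A) / 2.
Definition center (A : rect) : C := mkC (xmid A) (ymid A).

Definition corner (A : rect) (t : C) : Prop :=
  (reC t = xl A \/ reC t = xr A) /\ (imC t = yb A \/ imC t = yt A).

(* A and B share a full vertical side, A being on the left. *)
Definition left_of (A B : rect) : Prop :=
  [/\ xr A = xl B, yb A = yb B & yt A = yt B].

(* A and B share a full horizontal side, A being below. *)
Definition below (A B : rect) : Prop :=
  [/\ yt A = yb B, xl A = xl B & xr A = xr B].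

Definition line_reflection (s t z : C) : C :=
  s + (t - s) / (t - s)^* * (z - s)^*.

(* The line through the upper left and lower right vertices of a square P0 is
   x + y = xl P0 + yt P0; see [reflect_rectP]. *)
Definition reflect_rect (P0 A : rect) : rect :=
  let s := xl P0 + yt P0 in Rect (s - yt A) (s - yb A) (s - xr A) (s - xl A).

Section Polygon.
Variable P : nat -> rect.

Definition polygon_shape : Prop :=
  [/\ forall i, (i < g)%N -> nondegenerate (P i),
      is_square (P 0%N),
      ~~ odd g ->
        (forall i, (i <= (g - 2)./2)%N -> left_of (P i.*2) (P i.*2.+1)) /\
        (forall i, (1 <= i <= (g - 2)./2)%N -> below (P i.*2.-1) (P i.*2))
    & odd g ->
        (forall i, (i <= (g - 3)./2)%N -> below (P i.*2) (P i.*2.+1)) /\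
        (forall i, (1 <= i <= (g - 1)./2)%N -> left_of (P i.*2.-1) (P i.*2))].

Definition Q (i : nat) : rect := reflect_rect (P 0%N) (P i).

(* The chain Q_(g-1), ..., Q_1, P_0, P_1, ..., P_(g-1), indexed from 0 to
   2g - 2. *)
Definition chain (m : nat) : rect :=
  if (m < g.-1)%N then Q (g.-1 - m) else P (m - g.-1).

Definition nchain : nat := g.*2.-1.

(* By [chain_adjacent], the rows, from bottom to top, are {chain 0},
   {chain 1, chain 2}, ..., {chain (2g-3), chain (2g-2)}, and the columns, from
   left to right, are {chain 0, chain 1}, ..., {chain (2g-4), chain (2g-3)},
   {chain (2g-2)}.  They are numbered from 0 to g - 1. *)
Definition row_left (k : nat) : rect := chain k.*2.-1.
Definition row_right (k : nat) : rect := chain k.*2.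
Definition col_bottom (k : nat) : rect := chain k.*2.
Definition col_top (k : nat) : rect := chain (minn k.*2.+1 g.-1.*2).

Definition polygon : set C :=
  [set t | exists2 m, (m < nchain)%N & rect_set (chain m) t].

Definition vertex (t : C) : Prop :=
  exists2 m, (m < nchain)%N & corner (chain m) t.

(* The translations carrying, in each row, the left side of the leftmost
   rectangle to the right side of the rightmost one and, in each column, the
   bottom side of the lowest rectangle to the top side of the highest one. *)
Definition glue_step (s t : C) : Prop :=
  exists2 k, (k < g)%N &
    [/\ reC s = xl (row_left k), yb (row_left k) <= imC s <= yt (row_left k)
      & t = s + mkC (xr (row_right k) - xl (row_left k)) 0] \/
    [/\ imC s = yb (col_bottom k),
        xl (col_bottom k) <= reC s <= xr (col_bottom k)
      & t = s + mkC 0 (yt (col_top k) - yb (col_bottom k))].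

Definition glued : C -> C -> Prop :=
  Relation_Operators.clos_refl_sym_trans C glue_step.

Section Identification.
Variable Phi : C -> Xpt.

(* Expression phi of Phi in the local coordinate zeta of the glued surface
   around the (non-vertex) point s of the polygon: if s lies on a side of the
   polygon, the points zeta near s but outside of the polygon are first
   translated along with s to the opposite side. *)
Definition translation_chart (s : C) (phi : C -> Xpt) : Prop :=
  \forall zeta \near s, forall t : C, polygon t -> glued s t ->
    polygon (zeta + (t - s)) -> phi zeta = Phi (zeta + (t - s)).

(* Phi induces a biholomorphism from the glued surface to X with
   d zeta = c dz/w.  The vertices are isolated points of the glued surface, at
   which its complex structure is the unique extension of the one given by the
   translation charts, so that continuity suffices there by the removable
   singularity theorem. *)
Definition biholomorphic_identification (c : R) : Prop :=
  [/\ {within polygon, continuous Phi},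
      Phi @` polygon = surface,
      forall s t, polygon s -> polygon t -> (Phi s = Phi t <-> glued s t)
    & forall s, polygon s -> ~ vertex s ->
        exists2 phi, translation_chart s phi &
          \forall zeta \near s, holomorphic_at phi zeta /\
            toC c * pull (@derive1 C C) dz_over_w phi zeta = 1].

Definition marked_points : Prop :=
  [/\ Phi (center (P 0%N)) = Some (0, 0),
      forall j, (1 <= j < g)%N -> Phi (center (P j)) = Some (toC (bp j), 0),
      forall j, (1 <= j < g)%N -> Phi (center (Q j)) = Some (- toC (bp j), 0),
      Phi (mkC (xmid (P g.-1)) (yt (P g.-1))) = Some (toC (bp g), 0)
    & Phi (mkC (xl (Q g.-1)) (ymid (Q g.-1))) = Some (- toC (bp g), 0)].

Definition alpha (k : nat) : path :=
  Path (xl (row_left k)) (xr (row_right k))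
       (fun t => Phi (mkC t (ymid (row_right k)))).

Definition beta (k : nat) : path :=
  Path (yb (col_bottom k)) (yt (col_top k))
       (fun t => Phi (mkC (xmid (col_bottom k)) t)).

Definition alpha_cycle (k : nat) : cycle := [:: (1, alpha k)].

Definition gamma_cycle (j : nat) : cycle :=
  [seq ((-1) ^+ (k - j), beta k) | k <- iota j (g - j)].

End Identification.
End Polygon.

(* The improper integrals are Lebesgue integrals (the integrand is nonnegative
   on [s, t] when 0 <= s).  In the matrices below, rows and columns are numbered
   from 0: the entry (j, k) is the one usually indexed by (j + 1, k + 1). *)
Definition abs_integral (j : nat) (s t : R) : R :=
  (\int[lebesgue_measure]_(x in `[s, t])
     (x ^+ j / Num.sqrt `|curve_poly.[x]|))%R.

Definition Iint (j k : nat) : R :=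
  if (k.+1.*2 <= g.+1)%N
  then (-1) ^+ j * abs_integral j (bp (g.+1 - k.+1.*2)) (bp (g.+2 - k.+1.*2))
  else abs_integral j (bp (k.+1.*2 - g.+2)) (bp (k.+1.*2 - g.+1)).

Definition Pi0 : 'M[C]_g := \matrix_(j, k) toC (Iint j k).

Definition Mmx : 'M[C]_g := \matrix_(j, k) ((-1) ^+ j *+ (j == k)).

Definition Nmx : 'M[C]_g :=
  \matrix_(j, k) if (j + k < g)%N then (-1) ^+ (g.-1 - j - k) else 0.

Lemma reflect_rectP (P0 A : rect) :
  nondegenerate P0 -> is_square P0 ->
  rect_set (reflect_rect P0 A) =
  line_reflection (mkC (xl P0) (yt P0)) (mkC (xr P0) (yb P0)) @` rect_set A.
Proof.
move=> [lt_x lt_y] sq.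
set r := line_reflection _ _.
have rE x y : r (mkC x y) = mkC (xl P0 + yt P0 - y) (xl P0 + yt P0 - x).
  have d0 : xr P0 - xl P0 != 0 by rewrite subr_eq0 gt_eqF.
  have -> : r (mkC x y) =
    (xl P0 +i* yt P0) + ((xr P0 - xl P0) +i* (yb P0 - yt P0)) /
    ((xr P0 - xl P0) -i* (yb P0 - yt P0)) * ((x - xl P0) -i* (y - yt P0)) by [].
  have -> : yb P0 - yt P0 = - (xr P0 - xl P0) by rewrite sq opprB.
  set d := xr P0 - xl P0 in d0 *; rewrite opprK.
  have -> : (d +i* - d) / (d +i* d) = - 'i%C :> R[i].
    have dd : (d +i* d : R[i]) != 0 by rewrite eq_complex /= negb_and d0.
    apply: (mulIf dd); rewrite divfK //.
    by apply/eqP; rewrite eq_complex /=; apply/andP; split; apply/eqP; ring.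
  by apply/eqP; rewrite eq_complex /=; apply/andP; split; apply/eqP; ring.
apply/seteqP; split=> [[x y]|_ [[x y] /= [/= hx hy] <-]].
  case=> /= hx hy.
  exists (mkC (xl P0 + yt P0 - y) (xl P0 + yt P0 - x)).
    by split; rewrite /= /reC /imC /=; lra.
  by rewrite rE; congr (_ +i* _); ring.
by rewrite -/(mkC x y) rE; split; rewrite /reC /imC /= in hx hy *; lra.
Qed.

Lemma P_adjacent (P : nat -> rect) (i : nat) :
  polygon_shape P -> (i.+1 < g)%N ->
  if odd (g + i) then below (P i) (P i.+1) else left_of (P i) (P i.+1).
Proof.
case=> _ _ even_g odd_g lt_ig; rewrite oddD.
case go: (odd g); last first.
  have [hl hb] := even_g (negbT go); rewrite addFb.
  case io: (odd i).
    have := hb (uphalf i); rewrite (_ : (uphalf i).*2.-1 = i); last by lia.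
    by rewrite (_ : (uphalf i).*2 = i.+1); last lia; apply; lia.
  have := hl i./2; rewrite (_ : i./2.*2 = i); last by lia.
  by apply; lia.
have [hb hl] := odd_g go; rewrite addTb.
case io: (odd i) => /=.
  have := hl (uphalf i); rewrite (_ : (uphalf i).*2.-1 = i); last by lia.
  by rewrite (_ : (uphalf i).*2 = i.+1); last lia; apply; lia.
have := hb i./2; rewrite (_ : i./2.*2 = i); last by lia.
by apply; lia.
Qed.

Lemma chain_adjacent (P : nat -> rect) (m : nat) :
  (2 <= g)%N -> polygon_shape P -> (m.+1 < nchain)%N ->
  if odd m then left_of (chain P m) (chain P m.+1)
  else below (chain P m) (chain P m.+1).
Proof.
move=> g2 shP; rewrite /nchain => lt_m.
have Q0 : Q P 0 = P 0%N.
  case: shP => _ + _ _; rewrite /Q /reflect_rect /is_square.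
  by case: (P 0%N) => u v b t /= sq; congr Rect; lra.
case: (ltnP m g.-1) => [lt_mg|le_gm]; last first.
  have /(P_adjacent shP) : ((m - g.-1).+1 < g)%N by lia.
  rewrite /chain ltnNge le_gm /= ltnNge leqW //= subSn //.
  by rewrite (_ : odd (g + (m - g.-1)) = ~~ odd m); last lia; case: odd.
have -> : chain P m = Q P (g.-2 - m).+1.
  by rewrite /chain lt_mg; congr Q; lia.
have -> : chain P m.+1 = Q P (g.-2 - m).
  rewrite /chain; case: ltnP => [_|le_gm]; first by congr Q; lia.
  by rewrite (_ : (g.-2 - m = 0)%N) ?Q0; last lia; congr P; lia.
have /(P_adjacent shP) : ((g.-2 - m).+1 < g)%N by lia.
rewrite (_ : odd (g + (g.-2 - m)) = odd m); last by lia.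
rewrite /Q /reflect_rect.
by case: ifP => _ [h1 h2 h3]; split => /=; rewrite ?h1 ?h2 ?h3.
Qed.

End Curve.

(* Main.v *)
Require Import Defs.
From HB Require Import structures.
From mathcomp Require Import all_boot all_order all_algebra complex separable zify ring lra.
From mathcomp Require Import all_classical all_reals all_analysis.
From mathcomp Require Import measurable_realfun.
Set Implicit Arguments.
Unset Strict Implicit.
Unset Printing Implicit Defensive.
Import Order.TTheory GRing.Theory Num.Theory numFieldNormedType.Exports.
Local Open Scope classical_set_scope.
Local Open Scope complex_scope.
Local Open Scope ring_scope.

(** In the coordinate [zeta] of the polygon the form [dz / w] is [d zeta / c], so
    that the functions [z] and [w] satisfy [z' = w / c] and [w' = f'(z) / (2 c)].
    Restricted to a horizontal or vertical line through the center of a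
    rectangle, this is the equation [x'' = k f'(x)] of a motion on the real axis
    ([k] is real: turning the direction by a right angle only changes its sign),
    which starts at rest from a real branch point.  Uniqueness of solutions,
    obtained from Gronwall's inequality ([gronwall]), has three consequences:
    [z] is real along the line ([trajectory_real]); the motion is symmetric about
    every point where it is at rest ([reflect_solution]); and it cannot come to
    rest strictly between two consecutive centers, since it would then retrace
    its path and [Phi] would identify two points of the line ([velocity_pos]).
    Hence [z] increases from one branch point to the next between consecutive
    centers, and there [d zeta = c dx / sqrt |f(x)|], up to the direction.

    A closed curve [alpha_k] or [beta_k] consists of such a segment and of two
    pieces which the symmetry folds back onto it.  Therefore the period of
    [z^j dz / w] is twice the real integral between two consecutive branch points
    for [alpha_k], and [2 i] times such an integral for [beta_k]; the intervals
    between the branch points are used alternately by rows and columns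
    ([line_periods], [row_periods], [column_periods]).  The substitution
    [x -> - x] maps the intervals of the columns to those of the rows in reverse
    order, at the cost of a sign [(-1)^j]; summing up, the periods over the
    [alpha_k] and [gamma_k] form the matrices [2 Pi0] and [2 i M Pi0 N].

    The forms [z^j dz / w], [j < g], are holomorphic and independent, so that
    they are related to any holomorphic basis by an invertible matrix
    ([basis_zform]), which cancels in [A^-1 C].  Finally [Pi0] is invertible: a
    vanishing combination of its rows gives a polynomial of degree less than [g]
    whose weighted integrals over [g] disjoint intervals are zero, so that it has
    a root in each of them ([realPi0_unit]).  Only [det M * det N = 1] remains to
    be computed for the determinant.

    The point at infinity never interferes: [dz / w] vanishes there whereas
    [d zeta] does not vanish, so that only vertices are sent to it
    ([affine_chart]). *)

(** * Real differential equations *)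

Section RealODE.
Variable R : realType.
Implicit Types (f g : R -> R) (t s e : R).

Lemma is_derive_mul f g t a b : is_derive t 1 f a -> is_derive t 1 g b ->
  is_derive t 1 (fun s => f s * g s) (f t * b + a * g t).
Proof.
move=> df dg; have := is_deriveM df dg => /is_derive_eq; apply.
by rewrite /GRing.scale /=; ring.
Qed.

Lemma is_derive_affine f (m k : R) t a : is_derive (m + k * t) 1 f a ->
  is_derive t 1 (fun s => f (m + k * s)) (k * a).
Proof.
move=> df.
have dl : is_derive t 1 (fun s : R => m + k * s) k.
  apply: is_derive_eq; rewrite add0r.
  by rewrite /GRing.scale /=; ring.
have := @is_derive1_comp _ f (fun s => m + k * s) t a k df dl => /is_derive_eq; apply; ring.
Qed.

Lemma continuous_affine f (m k : R) : continuous f ->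
  continuous (fun t : R => f (m + k * t)).
Proof.
move=> cf t; apply: (@continuous_comp _ _ _ (fun t : R => m + k * t) f); last exact: cf.
by apply: cvgD; [exact: cvg_cst|apply: cvgM; [exact: cvg_cst|exact: cvg_id]].
Qed.

(** The energy [d^2 + n^2] grows at most like [expR ((1 + K) t)] and starts from
    zero. *)
Lemma gronwall (d n n' : R -> R) (h K : R) : 0 <= K ->
  continuous d -> continuous n -> d 0 = 0 -> n 0 = 0 ->
  (forall t, 0 < t < h -> is_derive t 1 d (n t)) ->
  (forall t, 0 < t < h -> is_derive t 1 n (n' t)) ->
  (forall t, 0 < t < h -> `|n' t| <= K * `|d t|) ->
  forall t, 0 <= t <= h -> d t = 0 /\ n t = 0.
Proof.
move=> K0 cd cn d0 n0 dd dn bn t /andP[t0 th].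
pose E s := (d s * d s + n s * n s) * expR (- (1 + K) * s).
have dE s : 0 < s < h -> is_derive s 1 E
    ((2 * d s * n s + 2 * n s * n' s - (1 + K) * (d s * d s + n s * n s)) * expR (- (1 + K) * s)).
  move=> sh.
  have dexp : is_derive s 1 (fun s => expR (- (1 + K) * s)) (- (1 + K) * expR (- (1 + K) * s)).
    have := @is_derive_affine expR 0 (- (1 + K)) s _ (is_derive_expR _).
    rewrite add0r; congr is_derive; apply/funext => r; by rewrite add0r.
  have dsq := is_deriveD (is_derive_mul (dd s sh) (dd s sh)) (is_derive_mul (dn s sh) (dn s sh)).
  have := is_derive_mul dsq dexp => /is_derive_eq; apply; rewrite /=.
  rewrite [X in X * _ + _](_ : _ = d s * d s + n s * n s); last by [].
  ring.
have cE : continuous E.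
  move=> s; apply: cvgM; first by apply: cvgD; apply: cvgM; (exact: cd || exact: cn).
  apply: continuous_comp; last exact: continuous_expR.
  by apply: cvgM; [exact: cvg_cst|exact: cvg_id].
have E0 : E 0 = 0 by rewrite /E d0 n0 !mul0r addr0 mul0r.
have Et : E t <= 0.
  rewrite -E0; apply: (@ler0_derive1_le_cc _ E 0 h) => //.
  - by move=> s; rewrite in_itv /= => /dE [].
  - move=> s; rewrite in_itv /= => sh; rewrite derive1E.
    have -> := @derive_val _ _ _ _ _ _ _ (dE s sh).
    apply: mulr_le0_ge0; last exact: expR_ge0.
    have := bn s sh; move: (d s) (n s) (n' s) => D Nn N' H.
    have H2 : Nn * N' <= K * ((D * D + Nn * Nn) / 2).
      apply: (@le_trans _ _ (`|Nn| * (K * `|D|))).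
        by apply: le_trans (ler_norm _) _; rewrite normrM ler_wpM2l.
      rewrite mulrCA ler_wpM2l //.
      have := sqr_ge0 (`|Nn| - `|D|).
      have : `|Nn| * `|Nn| = Nn * Nn by rewrite -expr2 -expr2 real_normK ?num_real.
      have : `|D| * `|D| = D * D by rewrite -expr2 -expr2 real_normK ?num_real.
      nra.
    have := sqr_ge0 (Nn - D); nra.
  - exact: continuous_subspaceT.
  - by rewrite in_itv /= t0.
  - by rewrite in_itv /= lexx (le_trans t0).
have : d t * d t + n t * n t <= 0.
  by move: Et; rewrite /E pmulr_lle0 // expR_gt0.
have := sqr_ge0 (d t); have := sqr_ge0 (n t); rewrite !expr2 => h1 h2 h3.
have hd : d t * d t = 0 by lra.
have hn : n t * n t = 0 by lra.
by split; apply/eqP; rewrite -sqrf_eq0 expr2; apply/eqP.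
Qed.

Lemma bounded_segment f s e : continuous f ->
  exists2 B, 0 <= B & forall t, s <= t <= e -> `|f t| <= B.
Proof.
move=> cf; have [se|es] := leP s e; last first.
  by exists 0 => // t /andP[? ?]; exfalso; lra.
have cn : {within `[s, e], continuous (fun t => `|f t|)}.
  apply: continuous_subspaceT => t.
  by apply: (@continuous_comp _ _ _ f (fun x => `|x|)); [exact: cf|exact: norm_continuous].
have [m _ hm] := EVT_max se cn.
by exists `|f m| => // t ht; apply: hm; rewrite in_itv.
Qed.

Lemma horner_lipschitz (p : {poly R}) (B : R) : 0 <= B ->
  exists2 K, 0 <= K & forall x y, `|x| <= B -> `|y| <= B ->
    `|p.[x] - p.[y]| <= K * `|x - y|.
Proof.
move=> B0; suff [K [L [K0 L0 H]]] : exists K L, [/\ 0 <= K, 0 <= L &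
    forall x y, `|x| <= B -> `|y| <= B ->
    `|p.[x]| <= L /\ `|p.[x] - p.[y]| <= K * `|x - y|].
  by exists K => // x y hx hy; have [] := H x y hx hy.
elim/poly_ind: p => [|p c [K [L [K0 L0 H]]]].
  exists 0, 0; split=> // x y _ _; rewrite !horner0 subrr normr0 mul0r; split=> //.
exists (K * B + L), (L * B + `|c|); split=> [||x y hx hy]; rewrite ?addr_ge0 ?mulr_ge0 //.
rewrite !hornerE; have [h1 h2] := H x y hx hy; have [h3 _] := H y x hy hx; split.
  apply: le_trans (ler_normD _ _) _; rewrite lerD2r normrM.
  by apply: ler_pM.
rewrite (_ : _ - _ = (p.[x] - p.[y]) * x + p.[y] * (x - y)); last by ring.
apply: le_trans (ler_normD _ _) _; rewrite !normrM mulrDl; apply: lerD.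
  by rewrite mulrAC; apply: ler_pM.
by rewrite ler_wpM2r.
Qed.

(** A real polynomial is real on the real axis. *)
Lemma im_horner_le (p : {poly R}) (B : R) : 0 <= B ->
  exists2 K, 0 <= K & forall x y : R, `|x| <= B -> `|y| <= B ->
    `|imC (map_poly (@toC R) p).[mkC x y]| <= K * `|y|.
Proof.
move=> B0; suff [K [K0 H]] : exists K, 0 <= K /\
    forall x y : R, `|x| <= B -> `|y| <= B ->
    let q := (map_poly (@toC R) p).[mkC x y] in
    `|reC q| <= K /\ `|imC q| <= K * `|y|.
  by exists K => // x y hx hy; have [] := H x y hx hy.
elim/poly_ind: p => [|p c [K [K0 H]]].
  exists 0; split=> // x y _ _; rewrite rmorph0 horner0 /= /reC /imC /=.
  by rewrite normr0 mul0r.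
exists (K * B + K * B * B + `|c| + K); split=> [|x y hx hy].
  by rewrite !addr_ge0 ?mulr_ge0.
have [h1 h2] := H x y hx hy.
rewrite /= rmorphD rmorphM /= map_polyX map_polyC /= hornerMXaddC.
set q := (map_poly _ p).[_] in h1 h2 *.
have -> : reC (q * mkC x y + toC c) = reC q * x - imC q * y + c.
  by case: q h1 h2 => u v _ _ /=; rewrite /reC /imC /mkC /toC /=.
have -> : imC (q * mkC x y + toC c) = reC q * y + imC q * x.
  by case: q h1 h2 => u v _ _ /=; rewrite /reC /imC /mkC /toC /=; ring.
split.
  have e1 : `|reC q * x| <= K * B by rewrite normrM; apply: ler_pM.
  have e2 : `|imC q * y| <= K * B * B.
    rewrite normrM; apply: ler_pM => //; apply: (le_trans h2).
    by apply: ler_wpM2l.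
  have := ler_normD (reC q * x - imC q * y) c.
  have := ler_normB (reC q * x) (imC q * y).
  lra.
apply: le_trans (ler_normD _ _) _; rewrite !normrM.
have e1 : `|reC q| * `|y| <= K * `|y| by apply: ler_wpM2r.
have e2 : `|imC q| * `|x| <= K * `|y| * B by apply: ler_pM.
have : 0 <= K * B * B * `|y| by rewrite !mulr_ge0.
have : 0 <= `|c| * `|y| by rewrite !mulr_ge0.
nra.
Qed.

(** The imaginary parts of a solution of [z'' = k p(z)], with [p] and [k] real,
    satisfy a linear differential inequality, by [im_horner_le]; they vanish
    together with their initial values. *)
Lemma real_solution (p : {poly R}) (k s e t0 : R) (x y u : R -> R) :
  continuous x -> continuous y -> continuous u ->
  (forall t, s < t < e -> is_derive t 1 y (u t)) ->
  (forall t, s < t < e ->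
     is_derive t 1 u (k * imC (map_poly (@toC R) p).[mkC (x t) (y t)])) ->
  s < t0 < e -> y t0 = 0 -> u t0 = 0 ->
  forall t, s <= t <= e -> y t = 0 /\ u t = 0.
Proof.
move=> cx cy cu dy du /andP[sO Oe] yO uO.
have [B1 B10 hB1] := bounded_segment s e cx.
have [B2 B20 hB2] := bounded_segment s e cy.
have B0 : 0 <= Num.max B1 B2 by rewrite le_max B10.
have [K K0 hK] := im_horner_le p B0.
have b1 t : s <= t <= e -> `|x t| <= Num.max B1 B2.
  by move=> ht; rewrite le_max hB1.
have b2 t : s <= t <= e -> `|y t| <= Num.max B1 B2.
  by move=> ht; rewrite le_max hB2 // orbT.
have key (sg h : R) : sg * sg = 1 -> (forall t, 0 < t < h -> s < t0 + sg * t < e) ->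
    forall t, 0 <= t <= h -> y (t0 + sg * t) = 0 /\ u (t0 + sg * t) = 0.
  move=> sg2 hh t ht.
  have sgn : `|sg| = 1.
    by apply/eqP; rewrite -(eqrXn2 (n:=2)) // expr1n real_normK ?num_real// expr2 sg2.
  suff [-> e1] : y (t0 + sg * t) = 0 /\ sg * u (t0 + sg * t) = 0.
    split=> //; apply: (@mulfI _ sg); last by rewrite mulr0.
    by apply/eqP => z; move: sg2; rewrite z mul0r => /esym/eqP; rewrite oner_eq0.
  apply: (@gronwall (fun t => y (t0 + sg * t)) (fun t => sg * u (t0 + sg * t))
    (fun t => sg * (sg * (k * imC (map_poly (@toC R) p).[mkC (x (t0 + sg * t)) (y (t0 + sg * t))])))
    h (`|k| * K)) => //.
  - by rewrite mulr_ge0.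
  - exact: continuous_affine.
  - by move=> r; apply: cvgM; [exact: cvg_cst|exact: continuous_affine].
  - by rewrite mulr0 addr0.
  - by rewrite mulr0 addr0 uO mulr0.
  - by move=> r hr; apply: is_derive_affine; apply: dy; apply: hh.
  - move=> r hr.
    have := is_derive_mul (is_derive_cst sg r 1) (is_derive_affine (du _ (hh r hr))).
    by move=> /is_derive_eq; apply; rewrite mul0r addr0.
  - move=> r hr; rewrite !normrM sgn !mul1r -mulrA ler_wpM2l //.
    have /andP[? ?] := hh r hr.
    by apply: hK; [apply: b1|apply: b2]; apply/andP; split; apply: ltW.
move=> t /andP[st te]; have [Ot|tO] := leP t0 t.
  rewrite (_ : t = t0 + 1 * (t - t0)); last by ring.
  apply: (@key 1 (e - t0)); [by ring|by move=> r hr; lra|lra].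
rewrite (_ : t = t0 + -1 * (t0 - t)); last by ring.
by apply: (@key (-1) (t0 - s)); [by ring|by move=> r hr; lra|lra].
Qed.

(** Reversing time about a point of rest gives a solution with the same initial
    values. *)
Lemma reflect_solution (p : {poly R}) (k s e t0 : R) (x v : R -> R) :
  continuous x -> continuous v ->
  (forall t, s < t < e -> is_derive t 1 x (v t)) ->
  (forall t, s < t < e -> is_derive t 1 v (k * p.[x t])) ->
  s < t0 < e -> v t0 = 0 ->
  forall r, 0 <= r -> s <= t0 - r -> t0 + r <= e ->
    x (t0 + r) = x (t0 - r) /\ v (t0 + r) = - v (t0 - r).
Proof.
move=> cx cv dx dv /andP[sO Oe] vO r r0 sr re.
have [B B0 hB] := bounded_segment s e cx.
have [K K0 hK] := horner_lipschitz p B0.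
have [] := @gronwall (fun t => x (t0 + 1 * t) - x (t0 + (-1) * t))
   (fun t => v (t0 + 1 * t) + v (t0 + (-1) * t))
   (fun t => 1 * (k * p.[x (t0 + 1 * t)]) + (-1) * (k * p.[x (t0 + (-1) * t)]))
   r (`|k| * K) _ _ _ _ _ _ _ _ r.
- by rewrite mulr_ge0.
- by move=> t; apply: cvgB; apply: continuous_affine.
- by move=> t; apply: cvgD; apply: continuous_affine.
- by rewrite !mulr0 subrr.
- by rewrite !mulr0 addr0 vO addr0.
- move=> t ht.
  have h1 : s < t0 + 1 * t < e by lra.
  have h2 : s < t0 + (-1) * t < e by lra.
  have := is_deriveB (is_derive_affine (dx _ h1)) (is_derive_affine (dx _ h2)).
  by move=> /is_derive_eq; apply; ring.
- move=> t ht.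
  have h1 : s < t0 + 1 * t < e by lra.
  have h2 : s < t0 + (-1) * t < e by lra.
  exact: is_deriveD (is_derive_affine (dv _ h1)) (is_derive_affine (dv _ h2)).
- move=> t ht; rewrite mul1r mulN1r -mulrBr normrM -mulrA ler_wpM2l //.
  by apply: hK; apply: hB; lra.
- by rewrite r0 lexx.
rewrite mul1r mulN1r => /subr0_eq -> /eqP; rewrite addr_eq0 => /eqP ->; by [].
Qed.

(** If the motion came to rest at some [t] strictly between [S] and [T], the
    reflection about [t] of the nearer of the two points [S] and [T] would be
    another point in the same state.  So the velocity keeps its sign. *)
Lemma velocity_pos (p : {poly R}) (k s e S T : R) (x v : R -> R) :
  continuous x -> continuous v ->
  (forall t, s < t < e -> is_derive t 1 x (v t)) ->
  (forall t, s < t < e -> is_derive t 1 v (k * p.[x t])) ->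
  (forall t t', s < t < e -> s <= t' <= e -> x t = x t' -> v t = v t' -> t = t') ->
  s <= S -> S < T -> T <= e -> v S = 0 -> v T = 0 -> x S < x T ->
  forall t, S < t < T -> 0 < v t.
Proof.
move=> cx cv dx dv inj sS ST Te vS vT xST.
have v_neq0 t : S < t < T -> v t != 0.
  move=> ht; apply/eqP => vt.
  have ht' : s < t < e by lra.
  have := reflect_solution cx cv dx dv ht' vt.
  have [le2|gt2] := leP (t + (t - S)) T.
    move=> /(_ (t - S)) []; [lra|lra|lra|].
    rewrite (_ : t - (t - S) = S); last by ring.
    rewrite vS oppr0 => ex ev.
    move: le2; rewrite le_eqVlt => /predU1P[e2|lt2].
      by move: ex; rewrite e2 => ex; move: xST; rewrite ex ltxx.
    have : t + (t - S) = S; last by lra.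
    by apply: inj; rewrite ?ev ?ex //; lra.
  move=> /(_ (T - t)) []; [lra|lra|lra|].
  rewrite (_ : t + (T - t) = T); last by ring.
  rewrite vT => ex /esym/eqP; rewrite oppr_eq0 => /eqP ev.
  have : t - (T - t) = T; last by lra.
  by apply: inj; rewrite ?ev ?ex //; lra.
have dx' t : t \in `]S, T[ -> is_derive t 1 x (v t).
  by rewrite in_itv /= => ht; apply: dx; lra.
have [t0 t0i e0] := MVT ST dx' (continuous_subspaceT cx).
have {}t0i : S < t0 < T by move: t0i; rewrite in_itv.
have vt0 : 0 < v t0.
  by rewrite -(@pmulr_lgt0 _ (T - S)) ?subr_gt0 // -e0 subr_gt0.
move=> t ht; rewrite lt_neqAle eq_sym v_neq0 //= leNgt; apply/negP => vt.
have [tt|tt] := leP t t0.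
  have [|c] := @IVT R v t t0 0 tt (continuous_subspaceT cv).
    by rewrite ge_min le_max (ltW vt) (ltW vt0) orbT.
  rewrite in_itv /= => hc vc.
  have : v c != 0 by apply: v_neq0; lra.
  by rewrite vc eqxx.
have [|c] := @IVT R v t0 t 0 (ltW tt) (continuous_subspaceT cv).
  by rewrite ge_min le_max (ltW vt) (ltW vt0) orbT.
rewrite in_itv /= => hc vc.
have : v c != 0 by apply: v_neq0; lra.
by rewrite vc eqxx.
Qed.

End RealODE.

(** * Integrals along a trajectory *)

Section Integrals.
Variable R : realType.
Implicit Types (f g x v : R -> R) (t s e r w : R).
Local Notation mu := (@lebesgue_measure R).

Lemma integrable_segment f s e : continuous f -> mu.-integrable `[s, e] (EFin \o f).
Proof.
move=> cf; apply: continuous_compact_integrable; first exact: segment_compact.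
exact: continuous_subspaceT.
Qed.

Lemma Rintegral_split f s m e : continuous f -> s <= m -> m <= e ->
  (\int[mu]_(t in `[s, e]) f t =
   \int[mu]_(t in `[s, m]) f t + \int[mu]_(t in `[m, e]) f t)%R.
Proof.
move=> cf sm me.
have := @Rintegral_itvB _ f (BLeft s) (BRight e) m (integrable_segment s e cf).
rewrite !bnd_simp => /(_ sm me) h.
rewrite -(@Rintegral_itv_obnd_cbnd _ m (BRight e)).
  by rewrite -h addrC subrK.
apply: integrableS (integrable_segment m e cf) => //.
by apply: subset_itvr; rewrite bnd_simp.
Qed.

Lemma Rintegral_flip f (m p q : R) : continuous f -> p <= q ->
  (\int[mu]_(t in `[(m - q)%R, (m - p)%R]) f t =
   \int[mu]_(t in `[p, q]) f (m - t)%R)%R.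
Proof.
move=> cf pq; rewrite /Rintegral; congr fine.
pose F t : R := m - t.
have dF t : is_derive t 1 F (-1).
  have := is_deriveB (is_derive_cst m t 1) (is_derive_id t 1).
  by move=> /is_derive_eq; apply; rewrite sub0r.
have F'E : derive1 F = cst (-1).
  by apply/funext => t; rewrite derive1E; exact: (@derive_val _ _ _ _ _ _ _ (dF t)).
have cF : continuous F.
  by move=> t; apply: cvgB; [exact: cvg_cst|exact: cvg_id].
rewrite -/(F p) -/(F q) (@integration_by_substitution_decreasing R F f p q) //.
- by apply: eq_integral => t _; congr EFin; rewrite F'E !fctE opprK mulr1.
- by move=> b b' _ _ bb'; rewrite /F; lra.
- by rewrite F'E => t _; exact: cvg_cst.
- by rewrite F'E; exact: is_cvg_cst.
- by rewrite F'E; exact: is_cvg_cst.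
- split; first by move=> t _; have [] := dF t.
  + exact/cvg_at_right_filter/cF.
  + exact/cvg_at_left_filter/cF.
- exact: continuous_subspaceT.
Qed.

Lemma Rintegral_reflect f S r : continuous f -> 0 <= r ->
  (forall w, 0 <= w -> w <= r -> f (S + w) = f (S - w)) ->
  (\int[mu]_(t in `[(S - r)%R, S]) f t = \int[mu]_(t in `[S, (S + r)%R]) f t)%R.
Proof.
move=> cf r0 sym; have := @Rintegral_flip f (2 * S) S (S + r) cf.
rewrite (_ : 2 * S - (S + r) = S - r); last by ring.
rewrite (_ : 2 * S - S = S); last by ring.
move=> ->; last by lra.
apply: eq_Rintegral => t; rewrite inE /= in_itv /= => ht.
rewrite (_ : 2 * S - t = S - (t - S)); last by ring.
by rewrite -sym; first congr f; lra.
Qed.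

(** Reflection carries the pieces [s, S] and [T, e] onto [S, 2 S - s] and
    [2 T - e, T]; these fill [S, T] because [2 S - s = 2 T - e]. *)
Lemma Rintegral_fold f s e S T : continuous f ->
  s <= S -> S < T -> T <= e -> e - s = 2 * (T - S) ->
  (forall w, 0 <= w -> w <= S - s -> f (S + w) = f (S - w)) ->
  (forall w, 0 <= w -> w <= e - T -> f (T + w) = f (T - w)) ->
  (\int[mu]_(t in `[s, e]) f t = 2 * \int[mu]_(t in `[S, T]) f t)%R.
Proof.
move=> cf sS ST Te es symS symT.
have h1 := @Rintegral_reflect f S (S - s) cf.
have h2 := @Rintegral_reflect f T (e - T) cf.
rewrite (@Rintegral_split _ s S e) //; last by lra.
rewrite (@Rintegral_split _ S T e) //; last by lra.
rewrite (_ : S - (S - s) = s) in h1; last by ring.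
rewrite h1 ?subr_ge0 //.
rewrite (_ : T + (e - T) = e) in h2; last by ring.
rewrite -h2 ?subr_ge0 //.
rewrite (_ : S + (S - s) = T - (e - T)); last by lra.
rewrite (@Rintegral_split _ S (T - (e - T)) T) //; [ring|lra|lra].
Qed.

(** The primitive of [f] takes the same value at both ends, so that it has a
    critical point. *)
Lemma Rintegral_zero f S T : continuous f -> S < T ->
  (\int[mu]_(t in `[S, T]) f t = 0)%R -> exists2 t, S < t < T & f t = 0.
Proof.
move=> cf ST f0.
pose F t := (\int[mu]_(r in `[S, t]) f r)%R.
have dF t : t \in `]S, T[ -> is_derive t 1 F (f t).
  rewrite in_itv /= => /andP[St tT].
  have := @continuous_FTC1_closed R f S t T tT (integrable_segment S T cf) St (cf t).
  by rewrite derive1E => -[? <-]; exact: DeriveDef.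
have cF : {within `[S, T], continuous F}.
  exact: parameterized_integral_continuous (ltW ST) (integrable_segment S T cf).
have [t tST] := MVT ST dF cF.
rewrite {1}/F f0 /F set_itv1 Rintegral_set1 subrr => /esym/eqP.
rewrite mulf_eq0 subr_eq0 [T == S]gt_eqF // orbF => /eqP ft.
by exists t => //; move: tST; rewrite in_itv.
Qed.

(** The substitution y = x t on the closed subintervals of ]S, T[, where the
    integrands are continuous, passes to the limit by monotone convergence. *)
Lemma integral_substitution_oo (H phi x v : R -> R) S T : S < T ->
  continuous x -> continuous v -> continuous phi ->
  (forall t, S < t < T -> is_derive t 1 x (v t)) ->
  (forall t, S < t < T -> 0 < v t) ->
  (forall y, x S < y < x T -> {for y, continuous H}) ->
  (forall y, x S < y < x T -> 0 <= H y) ->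
  (forall t, S < t < T -> H (x t) * v t = phi t) ->
  (\int[mu]_(y in `[x S, x T]) H y = \int[mu]_(t in `[S, T]) phi t)%R.
Proof.
move=> ST cx cv cphi dx vpos cH H0 Hphi; rewrite /Rintegral; congr fine.
have incr : {in `[S, T] &, {homo x : a b / a < b}}.
  apply: gtr0_derive1_lt_cc; last exact: continuous_subspaceT.
  - by move=> t; rewrite in_itv /= => /dx [].
  - move=> t; rewrite in_itv /= => ht; rewrite derive1E.
    by have -> := @derive_val _ _ _ _ _ _ _ (dx t ht); exact: vpos.
have incr' a b : S <= a -> a < b -> b <= T -> x a < x b.
  by move=> ? ab ?; apply: incr => //; rewrite in_itv /=; apply/andP; split; lra.
have mono a b : S <= a -> a <= b -> b <= T -> x a <= x b.
  by move=> ?; rewrite le_eqVlt => /predU1P[-> //|ab] ?; exact/ltW/incr'.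
have mH : measurable_fun `]x S, x T[ H.
  apply: subspace_continuous_measurable_fun => //.
  by apply: continuous_in_subspaceT => y; rewrite inE /= in_itv /=; exact: cH.
have mphi : measurable_fun setT phi by exact: continuous_measurable_fun.
have phi0 t : S < t < T -> 0 <= phi t.
  move=> ht; rewrite -Hphi // mulr_ge0 ?(ltW (vpos t ht)) // H0 //.
  by have /andP[? ?] := ht; rewrite !incr' //; lra.
rewrite integral_itv_bndoo; last exact/measurable_EFinP.
rewrite [RHS]integral_itv_bndoo; last exact/measurable_EFinP/measurable_funTS.
(* The shift by 3 keeps [S + d n < T - d n] for every [n]. *)
pose d (n : nat) : R := (T - S) / (n.+3)%:R.
have dpos n : 0 < d n by rewrite divr_gt0 ?subr_gt0 // ltr0n.
have dlt n : d n + d n < T - S.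
  have -> : T - S = d n * (n.+3)%:R by rewrite /d divfK // pnatr_eq0.
  by rewrite -mulr2n -[ltLHS]mulr_natr ltr_pM2l // ltr_nat.
have dS m n : (m <= n)%N -> d n <= d m.
  move=> mn; rewrite ler_pM2l ?subr_gt0 // lef_pV2 ?posrE ?ltr0n // ler_nat.
  by rewrite !ltnS.
have dsmall r : 0 < r -> exists n, d n < r.
  move=> r0; pose n := Num.bound ((T - S) / r); exists n.
  rewrite /d ltr_pdivrMr ?ltr0n // mulrC -ltr_pdivrMr //.
  have : (T - S) / r < n%:R by apply: archi_boundP; rewrite divr_ge0 ?subr_ge0 ?ltW.
  move=> /lt_le_trans; apply.
  by rewrite ler_nat -addn3 leq_addr.
pose A n := [set` `[S + d n, T - d n]].
pose B n := [set` `[x (S + d n), x (T - d n)]].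
have inA n t : A n t -> S < t < T.
  by rewrite /A /= in_itv /= => /andP[h1 h2]; have := dpos n; lra.
have inB n y : B n y -> x S < y < x T.
  rewrite /B /= in_itv /= => /andP[h1 h2]; have := dpos n; have := dlt n => e1 e2.
  by rewrite (lt_le_trans _ h1) ?(le_lt_trans h2) ?incr' //; lra.
have nA : nondecreasing_seq A.
  move=> m n mn; rewrite subsetEset => t; rewrite /A /= !in_itv /=.
  by have := dS _ _ mn; move=> ? /andP[? ?]; apply/andP; split; lra.
have nB : nondecreasing_seq B.
  move=> m n mn; rewrite subsetEset => y; rewrite /B /= !in_itv /= => /andP[h1 h2].
  have e0 := dS _ _ mn; have e1 := dlt m; have e2 := dpos n.
  by rewrite (le_trans _ h1) ?(le_trans h2) ?mono //; lra.
have UA : \bigcup_n A n = `]S, T[%classic.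
  apply/seteqP; split => [t [n _ /inA]|t]; rewrite /= in_itv //= => /andP[h1 h2].
  have m0 : 0 < Num.min (t - S) (T - t) by rewrite lt_min !subr_gt0 h1.
  have [m] := dsmall _ m0; rewrite lt_min => /andP[? ?].
  by exists m => //; rewrite /A /= in_itv /=; apply/andP; split; lra.
have UB : \bigcup_n B n = `]x S, x T[%classic.
  apply/seteqP; split => [y [n _ /inB]|y]; rewrite /= in_itv //= => /andP[h1 h2].
  have hy : Num.min (x S) (x T) <= y <= Num.max (x S) (x T).
    by rewrite ge_min le_max (ltW h1) (ltW h2) orbT.
  have [t] := @IVT R x S T y (ltW ST) (continuous_subspaceT cx) hy.
  rewrite in_itv /= => /andP[St tT] xt.
  have : (\bigcup_n A n) t.
    rewrite UA /= in_itv /= !lt_neqAle St tT !andbT.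
    by apply/andP; split; apply/eqP => z; move: h1 h2; rewrite -xt z ltxx.
  case=> n _; rewrite /A /= in_itv /= => /andP[h3 h4]; exists n => //.
  have e1 := dlt n; have e2 := dpos n.
  by rewrite /B /= in_itv /= -xt; apply/andP; split; apply: mono; lra.
have step n : (\int[mu]_(y in B n) (H y)%:E = \int[mu]_(t in A n) (phi t)%:E)%E.
  have e1 := dlt n; have e2 := dpos n.
  have dx' t : S + d n <= t <= T - d n -> derive1 x t = v t.
    move=> ht; rewrite derive1E; apply: (@derive_val _ _ _ _ _ _ _ (dx t _)); lra.
  rewrite /B (@integration_by_substitution_increasing R x H (S + d n) (T - d n)).
  - apply: eq_integral => t; rewrite inE /A /= in_itv /= => ht; congr EFin.
    rewrite -Hphi; last lra.
    by rewrite !fctE dx'.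
  - lra.
  - by move=> a b; rewrite !in_itv /= => ha hb ab; apply: incr'; lra.
  - move=> t ht.
    have nt : \forall r \near t, v r = derive1 x r.
      near=> r; rewrite dx' //.
      suff : r \in `]S + d n, T - d n[ by rewrite in_itv /= => /andP[*]; lra.
      by near: r; exact: near_in_itvoo.
    move: ht; rewrite in_itv /= => ht.
    rewrite /continuous_at dx'; last lra.
    by apply: cvg_trans (cv t); apply: near_eq_cvg.
  - apply/cvg_ex; exists (v (S + d n)).
    apply: (cvg_trans _ (cvg_at_right_filter (cv (S + d n)))); apply: near_eq_cvg.
    near=> r; rewrite dx' //; apply/andP; split.
      by near: r; exact: nbhs_right_ge.
    by near: r; apply: nbhs_right_le; lra.
  - apply/cvg_ex; exists (v (T - d n)).
    apply: (cvg_trans _ (cvg_at_left_filter (cv (T - d n)))); apply: near_eq_cvg.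
    near=> r; rewrite dx' //; apply/andP; split.
      by near: r; apply: nbhs_left_ge; lra.
    by near: r; exact: nbhs_left_le.
  - split.
    + by move=> t; rewrite in_itv /= => ht; have [] := dx t _; first lra.
    + exact/cvg_at_right_filter/cx.
    + exact/cvg_at_left_filter/cx.
  - apply: continuous_in_subspaceT => y; rewrite inE => yB; apply: cH.
    exact: (inB n).
rewrite -UB -UA.
have c1 : (\int[mu]_(y in B n) (H y)%:E @[n --> \oo] -->
           \int[mu]_(y in \bigcup_n B n) (H y)%:E)%E.
  apply: ge0_nondecreasing_set_cvg_integral => //.
  - by move=> n; exact: measurable_itv.
  - move=> n; apply/measurable_EFinP; apply: measurable_funS mH => // y /inB.
    by rewrite /= in_itv.
  - by move=> n y /inB; rewrite lee_fin; exact: H0.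
have c2 : (\int[mu]_(t in A n) (phi t)%:E @[n --> \oo] -->
           \int[mu]_(t in \bigcup_n A n) (phi t)%:E)%E.
  apply: ge0_nondecreasing_set_cvg_integral => //.
  - by move=> n; exact: measurable_itv.
  - by move=> n; apply/measurable_EFinP; exact: measurable_funTS.
  - by move=> n t /inA; rewrite lee_fin; exact: phi0.
apply: cvg_unique c1 _; first exact: ereal_hausdorff.
apply: cvg_trans c2; apply: near_eq_cvg; apply: nearW => n.
exact/esym/step.
Unshelve. all: by end_near. Qed.

End Integrals.

(** * The two affine models of the curve *)

Section BranchPoints.
Variables (R : realType) (g : nat) (a : nat -> R).
Local Notation C := (Cplx R).
Hypothesis g2 : (2 <= g)%N.
Hypothesis a1 : 1 < a 1%N.
Hypothesis incr_a : forall j : nat, (1 <= j)%N -> (j.+1 < g)%N -> a j < a j.+1.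

Lemma bp_lt m n : (m < n)%N -> (n <= g)%N -> bp a m < bp a n.
Proof.
elim: n => // n IH; rewrite ltnS => mn ng.
have step : bp a n < bp a n.+1.
  case: n ng {IH mn} => [|[|n]] ng //=.
  exact: incr_a.
move: mn; rewrite leq_eqVlt => /predU1P[-> //|mn].
by rewrite (lt_trans _ step) // IH // ltnW.
Qed.

Lemma bp_ge0 m : (m <= g)%N -> 0 <= bp a m.
Proof. by case: m => [//|m] mg; apply: ltW; apply: (@bp_lt 0). Qed.

Lemma simple_root_prod_XsubC (F : fieldType) (cs : seq F) y :
  uniq cs -> root (\prod_(x <- cs) ('X - x%:P)) y ->
  (\prod_(x <- cs) ('X - x%:P))^`().[y] != 0.
Proof.
by rewrite -separable_prod_XsubC unlock => sep; apply: coprimep_root.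
Qed.

Lemma curve_polyE :
  curve_poly g a = 'X * \prod_(1 <= j < g.+1) ('X^2 - (bp a j ^+ 2)%:P).
Proof.
rewrite /curve_poly -mulrA; congr (_ * _); rewrite big_nat_recl ?(ltnW g2) //=.
rewrite expr1n; congr (_ * _); rewrite [RHS]big_nat [LHS]big_nat.
by apply: eq_bigr; case.
Qed.

(** As a product over the squares of the branch points, [f / X] is separable in
    [X^2]. *)
Lemma fzE : fz g a = 'X * ((\prod_(c <- [seq toC (bp a j) ^+ 2 | j <- index_iota 1 g.+1])
                      ('X - c%:P)) \Po 'X^2).
Proof.
rewrite /fz curve_polyE rmorphM /= map_polyX; congr (_ * _).
rewrite rmorph_prod /= big_map rmorph_prod /=; apply: eq_bigr => j _.
rewrite rmorphB /= map_polyXn map_polyC /= rmorphXn /=.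
by rewrite rmorphB /= comp_polyX comp_polyC.
Qed.

Lemma fz_simple (y : C) : (fz g a).[y] = 0 -> (fz g a)^`().[y] != 0.
Proof.
rewrite fzE; set cs := [seq _ | _ <- _]; set G := \prod_(_ <- _) _.
have ucs : uniq cs.
  rewrite map_inj_in_uniq ?iota_uniq // => i j.
  rewrite !mem_index_iota => /andP[i1 ig] /andP[j1 jg].
  rewrite -!rmorphXn /= => -[] /eqP; rewrite eqrXn2 ?bp_ge0 // => /eqP eij.
  by case: (ltngtP i j) => // h; [have := bp_lt h jg|have := bp_lt h ig];
    rewrite eij ltxx.
rewrite hornerM hornerX horner_comp hornerXn => /eqP; rewrite mulf_eq0.
rewrite derivM derivX mul1r deriv_comp derivXn !hornerE horner_comp.
rewrite !hornerE /= ?hornerXn.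
have [-> _|y0 /= Gy] := eqVneq y 0.
  rewrite !mul0r addr0 horner_comp hornerXn expr0n /= /G horner_prod.
  rewrite prodf_seq_neq0; apply/allP => c /mapP[j jg ->]; apply/implyP => _.
  rewrite !hornerE oppr_eq0 expf_neq0 //.
  have : 0 < bp a j by apply: (@bp_lt 0); move: jg; rewrite mem_index_iota; lia.
  by move=> h; rewrite fmorph_eq0 gt_eqF.
have G'y := simple_root_prod_XsubC ucs Gy.
rewrite horner_comp hornerXn (rootP Gy) add0r.
rewrite mulf_neq0 // ?mulf_neq0 //.
by rewrite expr1 -mulr2n mulrn_eq0.
Qed.

(** The relation [q = X^n p(1/X)], expressed by values and first derivatives at
    inverse points: in this form it passes to products. *)
Definition reversal (n : nat) (p q : {poly C}) : Prop :=
  forall y y' : C, y * y' = 1 ->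
    q.[y] * y' ^+ n = p.[y'] /\
    q^`().[y] * y' ^+ n = n%:R * y' * p.[y'] - y' ^+ 2 * p^`().[y'].

Lemma reversalM n1 n2 p1 p2 q1 q2 :
  reversal n1 p1 q1 -> reversal n2 p2 q2 -> reversal (n1 + n2) (p1 * p2) (q1 * q2).
Proof.
move=> r1 r2 y y' yy'; have [v1 d1] := r1 y y' yy'; have [v2 d2] := r2 y y' yy'.
rewrite !derivM !hornerD !hornerM exprD natrD; split; first by rewrite -v1 -v2; ring.
transitivity (q1^`().[y] * y' ^+ n1 * (q2.[y] * y' ^+ n2)
  + q1.[y] * y' ^+ n1 * (q2^`().[y] * y' ^+ n2)); first by ring.
by rewrite v1 v2 d1 d2; ring.
Qed.

Lemma reversal_curve : reversal g.+1.*2 (fz g a) (fx g a).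
Proof.
have quad (b : R) : reversal 2 (map_poly (@toC R) ('X^2 - b%:P))
                               (map_poly (@toC R) (1 - b *: 'X^2)).
  move=> y y' yy'.
  have -> : map_poly (@toC R) ('X^2 - b%:P) = 'X^2 - (toC b)%:P.
    by rewrite rmorphB /= map_polyXn map_polyC.
  have -> : map_poly (@toC R) (1 - b *: 'X^2) = 1 - toC b *: 'X^2.
    by rewrite rmorphB /= rmorph1 map_polyZ map_polyXn.
  move: (toC b) => d.
  rewrite !(derivB, derivC, derivZ, derivXn) expr1.
  rewrite !(hornerD, hornerN, hornerZ, hornerMn, hornerXn, hornerC, hornerX).
  rewrite !mulr2n; split.
    by transitivity (y' ^+ 2 - d * (y * y') ^+ 2); [ring|rewrite yy'; ring].
  by transitivity (- (2 * d * y' * (y * y'))); [ring|rewrite yy'; ring].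
have mM (p q : {poly R}) : map_poly (@toC R) (p * q) = map_poly (@toC R) p * map_poly (@toC R) q.
  exact: rmorphM.
have prod (s : seq nat) : reversal (size s).*2
    (map_poly (@toC R) (\prod_(j <- s) ('X^2 - (a j ^+ 2)%:P)))
    (map_poly (@toC R) (\prod_(j <- s) (1 - (a j ^+ 2) *: 'X^2))).
  elim: s => [|j s IH].
    have m1 : map_poly (@toC R) 1 = 1 by exact: rmorph1.
    rewrite !big_nil m1 => y y' _; rewrite !derivC !hornerC [size _]/= double0 expr0.
    by split; ring.
  by rewrite !big_cons !mM (_ : (size (j :: s)).*2 = (2 + (size s).*2)%N) //; apply: reversalM.
rewrite /fz /fx /curve_poly /curve_poly_inf !mM -!mulrA.
have X2 : reversal 2 (map_poly (@toC R) 'X) (map_poly (@toC R) 'X).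
  move=> y y' yy'; rewrite (map_polyX (@toC R)) derivX !hornerC !hornerX.
  by split; [transitivity (y' * (y * y')); [ring|rewrite yy'; ring]|ring].
have -> : g.+1.*2 = (2 + (2 + (size (index_iota 1 g)).*2))%N.
  by rewrite size_iota; clear -g2; lia.
apply: reversalM => //; apply: reversalM => //.
by have := quad 1; rewrite scale1r.
Qed.

(** The nonzero roots of [fx] are the inverses of those of [fz], where the
    derivatives are proportional. *)
Lemma fx_simple (y : C) : (fx g a).[y] = 0 -> (fx g a)^`().[y] != 0.
Proof.
have [-> _|y0 fy] := eqVneq y 0.
  rewrite /fx /curve_poly_inf -mulrA rmorphM /= (map_polyX (@toC R)) derivM derivX.
  rewrite hornerD hornerM hornerC mul1r [('X * _).[0]]hornerM hornerX mul0r addr0.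
  rewrite -(rmorph0 (@toC R)) horner_map /= fmorph_eq0.
  rewrite hornerM horner_prod big1 => [|j _].
    by rewrite !(hornerD, hornerN, hornerXn, hornerC) expr0n /= mulr1 subr0 oner_neq0.
  by rewrite !(hornerD, hornerN, hornerZ, hornerXn, hornerC) expr0n /= mulr0 subr0.
have [v d] := reversal_curve (mulfV y0).
have fz0 : (fz g a).[y^-1] = 0 by rewrite -v fy mul0r.
apply/eqP => z; move: d; rewrite z fz0 mul0r mulr0 sub0r => /esym/eqP.
by rewrite oppr_eq0 mulf_eq0 expf_eq0 /= invr_eq0 (negPf y0) (negPf (fz_simple fz0)).
Qed.

End BranchPoints.

(** * Holomorphic forms *)

Section Forms.
Variables (R : realType).
Local Notation C := (Cplx R).

Lemma is_derive_horner (K : numFieldType) (V : normedModType K) (p : {poly K})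
    (f : V -> K) (x v : V) (df : K) :
  is_derive x v f df -> is_derive x v (fun y => p.[f y]) (p^`().[f x] * df).
Proof.
move=> dfx; elim/poly_ind: p => [|p c IH].
  rewrite deriv0 horner0 mul0r.
  rewrite (_ : (fun y => _) = cst 0); first exact: is_derive_cst.
  by apply/funext => y; rewrite horner0.
rewrite (_ : (fun y => _) = (fun y => p.[f y]) * f + cst c); last first.
  by apply/funext => y; rewrite hornerMXaddC.
have := is_deriveD (is_deriveM IH dfx) (is_derive_cst c x v).
move=> /is_derive_eq; apply; rewrite derivMXaddC hornerD hornerMX.
by rewrite /GRing.scale /=; ring.
Qed.

Lemma is_derive_derive1 (K : numFieldType) (V : normedModType K) (f : K -> V) t :
  derivable f t 1 -> is_derive t 1 f (derive1 f t).
Proof. by move=> df; rewrite derive1E; exact: derivableP. Qed.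

(** Away from [v = 0] the form [r(u) du / v] is read in the coordinate [u], and
    elsewhere as [2 r(u) dv / h'(u)]; the two readings agree. *)
Lemma holomorphic_poly_du_over_v (h r : {poly C}) :
  (forall y, h.[y] = 0 -> h^`().[y] != 0) ->
  holomorphic_covector h (fun p => (r.[p.1] * (du_over_v h p).1,
                                    r.[p.1] * (du_over_v h p).2)).
Proof.
move=> sep D q [oD qh dq param] t Dt.
have nD : \forall s \near t, D s by exact: open_nbhs_nbhs.
have rel s : D s -> ((q s).2 * derive1 (snd \o q) s) *+ 2 =
                    h^`().[(q s).1] * derive1 (fst \o q) s.
  move=> Ds; have [d1 d2] := dq s Ds.
  have e1 := is_derive_horner h (is_derive_derive1 d1).
  have e2 := is_deriveM (is_derive_derive1 d2) (is_derive_derive1 d2).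
  have e3 : is_derive s (1 : C) (fun s => h.[(q s).1])
     ((q s).2 *: derive1 (snd \o q) s + (q s).2 *: derive1 (snd \o q) s).
    apply: near_eq_is_derive e2; apply: filterS (open_nbhs_nbhs (conj oD Ds)).
    by move=> s' Ds'; rewrite -(qh s' Ds') expr2.
  have := @derive_val _ _ _ _ _ _ _ e1; rewrite (@derive_val _ _ _ _ _ _ _ e3).
  by rewrite mulr2n.
have dr s : D s -> derivable (fun s => r.[(q s).1]) s 1.
  move=> Ds; have [d1 _] := dq s Ds.
  by have [] := is_derive_horner r (is_derive_derive1 d1).
case: param => coord.
- have d1 s : D s -> derive1 (fst \o q) s = 1.
    move=> Ds; rewrite derive1E -[RHS](@derive_val _ _ _ s 1 id).
    apply: near_eq_derive; apply: filterS (open_nbhs_nbhs (conj oD Ds)).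
    by move=> s' /coord.
  have q0 s : D s -> (q s).2 != 0.
    move=> Ds; apply/eqP => z.
    have : h.[(q s).1] = 0 by rewrite -(qh s Ds) z expr0n.
    by move=> /sep; have := rel s Ds; rewrite z mul0r mul0rn d1 // mulr1 => <-; rewrite eqxx.
  apply: (@near_eq_derivable _ _ _ (fun s => r.[(q s).1] * (q s).2^-1)).
    apply: filterS nD => s Ds.
    by rewrite /pairing /du_over_v (negPf (q0 s Ds)) /= d1 // mulr0 mul0r addr0 mulr1.
  apply: derivableM; first exact: dr.
  by apply: derivableV; [exact: q0|have [] := dq t Dt].
- have d2 s : D s -> derive1 (snd \o q) s = 1.
    move=> Ds; rewrite derive1E -[RHS](@derive_val _ _ _ s 1 id).
    apply: near_eq_derive; apply: filterS (open_nbhs_nbhs (conj oD Ds)).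
    by move=> s' /coord.
  have h0 s : D s -> h^`().[(q s).1] != 0.
    move=> Ds; have [z|nz] := eqVneq (q s).2 0.
      by apply: sep; rewrite -(qh s Ds) z expr0n.
    apply/eqP => z; have /eqP := rel s Ds.
    by rewrite z mul0r d2 // mulr1 mulrn_eq0 (negPf nz).
  apply: (@near_eq_derivable _ _ _ (fun s => r.[(q s).1] * (2 * (h^`().[(q s).1])^-1))).
    apply: filterS nD => s Ds; rewrite /pairing /du_over_v.
    case: ifPn => [_|nz] /=; first by rewrite d2 // mulr0 mul0r add0r mulr1.
    rewrite mulr0 mul0r addr0 -mulrA; congr (_ * _).
    have := rel s Ds; rewrite d2 // mulr1 => e.
    apply: (mulfI nz); rewrite mulVKf //.
    apply: (mulfI (h0 s Ds)); rewrite -e; field; exact: h0.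
  apply: derivableM; first exact: dr.
  apply: derivableM; first exact: derivable_cst.
  apply: derivableV; first exact: h0.
  have [d1 _] := dq t Dt.
  by have [] := is_derive_horner h^`() (is_derive_derive1 d1).
Qed.

End Forms.

Section Basis.
Variables (R : realType) (g : nat) (a : nat -> R).
Local Notation C := (Cplx R).
Hypothesis g2 : (2 <= g)%N.
Hypothesis a1 : 1 < a 1%N.
Hypothesis incr_a : forall j : nat, (1 <= j)%N -> (j.+1 < g)%N -> a j < a j.+1.

(** [z^j dz / w], which is [- x^(g-1-j) dx / y] at infinity. *)
Definition zform (j : nat) : oneform R :=
  OneForm (fun p => let u := du_over_v (fz g a) p in (p.1 ^+ j * u.1, p.1 ^+ j * u.2))
          (fun p => let u := du_over_v (fx g a) p in
             (- p.1 ^+ (g.-1 - j) * u.1, - p.1 ^+ (g.-1 - j) * u.2)).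

(** On the tangent line, [du / v] is read from either component of the tangent
    vector. *)
Lemma du_over_v_tangent (h : {poly C}) p v : plane_curve h p -> tangent h p v ->
  h^`().[p.1] != 0 \/ p.2 != 0 ->
  pairing (du_over_v h p) v * p.2 = v.1 /\
  pairing (du_over_v h p) v * h^`().[p.1] = v.2 *+ 2.
Proof.
rewrite /plane_curve /tangent /pairing /du_over_v /= => ph tg sm.
case: ifPn => [/eqP z|nz] /=.
  have h0 : h^`().[p.1] != 0 by case: sm => //; rewrite z eqxx.
  have v0 : v.1 = 0.
    by apply: (mulfI h0); rewrite -tg z mul0r mul0rn mulr0.
  by rewrite v0 z !(mulr0, mul0r, add0r); split=> //; rewrite -mulr_natr; field.
rewrite mul0r addr0; split; first by rewrite mulrAC mulVf // mul1r.
apply: (mulfI nz); rewrite mulrnAr tg; field; exact: nz.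
Qed.

Lemma zform_compatible j : (j < g)%N -> compatible g a (zform j).
Proof.
move=> jg p v cp tp p0.
have [V D] := reversal_curve a g2 (mulVf p0).
have yy' : p.1^-1 * p.1 = 1 by rewrite mulVf.
have powE : p.1^-1 ^+ (g.-1 - j) = p.1 ^+ j * p.1^-1 ^+ g.-1.
  rewrite (_ : p.1^-1 ^+ g.-1 = p.1^-1 ^+ (g.-1 - j) * p.1^-1 ^+ j); last first.
    by rewrite -exprD; congr (_ ^+ _); lia.
  by rewrite mulrCA -exprMn mulfV // expr1n mulr1.
rewrite /pairing /zform /= {1}/du_over_v.
have [w0|w0] /= := eqVneq p.2 0.
  have h0 : (fz g a)^`().[p.1] != 0.
    by apply: fz_simple => //; rewrite -cp w0 expr0n.
  have v0 : v.1 = 0.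
    by apply: (mulfI h0); rewrite -tp w0 mul0r mul0rn mulr0.
  have fz0 : (fz g a).[p.1] = 0 by rewrite -cp w0 expr0n.
  rewrite /du_over_v w0 mul0r eqxx /= v0 !mulr0 !mul0r !add0r subr0 powE.
  move: D; rewrite fz0 mulr0 sub0r => D.
  have D' : (fx g a)^`().[p.1^-1] = - p.1 ^+ 2 * (fz g a)^`().[p.1] / p.1 ^+ g.+1.*2.
    by rewrite mulNr -D mulfK // expf_neq0.
  rewrite D' -addnn exprD.
  have -> : p.1^-1 ^+ g.-1 = p.1 ^+ 2 / p.1 ^+ g.+1.
    rewrite exprVn (_ : g.+1 = 2 + g.-1)%N; last by lia.
    by rewrite exprD invfM mulrA mulfV ?expf_neq0 // mul1r.
  have := expf_neq0 g.+1 p0; move: (p.1 ^+ g.+1) => P P0.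
  by field; rewrite P0 p0 h0.
rewrite /du_over_v (negPf w0) /= mulf_eq0 (negPf w0) invr_eq0 expf_eq0 /= (negPf p0) /=.
rewrite !(mulr0, mul0r, addr0) powE.
rewrite (_ : g.+1 = 2 + g.-1)%N; last by lia.
rewrite exprD exprVn.
have := expf_neq0 g.-1 p0; move: (p.1 ^+ g.-1) => P P0.
by field; rewrite P0 p0 w0.
Qed.

Lemma zform_holomorphic j : (j < g)%N -> holomorphic_form g a (zform j).
Proof.
move=> jg; split; first exact: zform_compatible.
- have := @holomorphic_poly_du_over_v R (fz g a) 'X^j (fz_simple g2 a1 incr_a).
  by congr holomorphic_covector; apply/funext => p; rewrite /= hornerXn.
- have := @holomorphic_poly_du_over_v R (fx g a) (- 'X^(g.-1 - j)) (fx_simple g2 a1 incr_a).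
  by congr holomorphic_covector; apply/funext => p; rewrite /= hornerN hornerXn.
Qed.

Lemma fz_neq0 : fz g a != 0.
Proof.
apply/eqP => z; have := fz_simple g2 a1 incr_a (y := 0).
by rewrite z deriv0 horner0 eqxx => /(_ erefl).
Qed.

(** The monomial forms are independent, so they form a basis as soon as some
    basis has [g] elements. *)
Lemma basis_zform (om : 'I_g -> oneform R) : holomorphic_basis g a om ->
  exists2 B : 'M[C]_g, B \in unitmx &
    (forall p v, plane_curve (fz g a) p -> tangent (fz g a) p v ->
    forall k, pairing (form_zw (om k) p) v =
       \sum_j B k j * (p.1 ^+ j * pairing (du_over_v (fz g a) p) v)).
Proof.
move=> [hom gen].
have : forall j : 'I_g, exists c : 'rV[C]_g, form_is_lincomb g a om c (zform j).
  by move=> j; have [c [hc _]] := gen _ (zform_holomorphic (ltn_ord j)); exists c.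
move=> /choice[cf hcf].
pose A : 'M[C]_g := \matrix_(j, k) cf j 0 k.
have hA p v : plane_curve (fz g a) p -> tangent (fz g a) p v ->
    forall j : 'I_g, p.1 ^+ j * pairing (du_over_v (fz g a) p) v =
    \sum_k A j k * pairing (form_zw (om k) p) v.
  move=> cp tp j; have [h _] := hcf j.
  transitivity (pairing (form_zw (zform j) p) v).
    by rewrite /pairing /=; ring.
  by rewrite h //; apply: eq_bigr => k _; rewrite mxE.
have uA : A \in unitmx.
  rewrite -row_free_unit -kermx_eq0; apply/rowV0P => r /sub_kermxP rA.
  pose P : {poly C} := \poly_(i < g) (if insub i is Some j then r 0 j else 0).
  have hP y : (fz g a).[y] != 0 -> P.[y] = 0.
    move=> fy; pose p : C * C := (y, sqrtC (fz g a).[y]).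
    pose v : C * C := (p.2 *+ 2, (fz g a)^`().[y]).
    have cp : plane_curve (fz g a) p by rewrite /plane_curve /= sqrtCK.
    have tp : tangent (fz g a) p v by rewrite /tangent /=; ring.
    have p20 : p.2 != 0 by rewrite /p /= sqrtC_eq0.
    have w2 : pairing (du_over_v (fz g a) p) v = 2.
      rewrite /pairing /du_over_v (negPf p20) /= mul0r addr0.
      by move: p20; rewrite /p /=; move: (sqrtC _) => w nz; field.
    (* This tangent vector is the one on which [dz / w] takes the value 2. *)
    have : \sum_(j < g) r 0 j * (y ^+ j * 2) = 0.
      transitivity (\sum_(j < g) r 0 j * \sum_k A j k * pairing (form_zw (om k) p) v).
        by apply: eq_bigr => j _; rewrite -hA // w2.
      under eq_bigr do rewrite mulr_sumr.
      rewrite exchange_big big1 // => k _.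
      have := congr1 (fun M : 'rV[C]_g => M 0 k) rA; rewrite !mxE => e.
      under eq_bigr do rewrite mulrA.
      by rewrite -mulr_suml e mul0r.
    under eq_bigr do rewrite mulrA.
    rewrite -mulr_suml => /eqP; rewrite mulf_eq0 pnatr_eq0 orbF => /eqP e.
    by rewrite horner_poly -[RHS]e; apply: eq_bigr => j _; rewrite valK.
  have /eqP : P * fz g a = 0.
    apply/eqP; apply: contraT => nz.
    pose s : seq C := [seq i%:R | i <- iota 0 (size (P * fz g a))].
    have us : uniq s.
      by rewrite map_inj_uniq ?iota_uniq // => i j /eqP; rewrite eqr_nat => /eqP.
    have rs : all (root (P * fz g a)) s.
      apply/allP => y _; rewrite rootE hornerM.
      by have [->|/hP ->] := eqVneq (fz g a).[y] 0; rewrite ?mulr0 ?mul0r.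
    by have := max_poly_roots nz rs us; rewrite size_map size_iota ltnn.
  rewrite mulf_eq0 (negPf fz_neq0) orbF => /eqP P0.
  apply/rowP => j; rewrite mxE.
  have := congr1 (fun Q : {poly C} => Q`_j) P0.
  by rewrite coef_poly ltn_ord valK coef0.
exists (invmx A); first by rewrite unitmx_inv.
move=> p v cp tp k.
under eq_bigr => j _ do rewrite hA // mulr_sumr.
rewrite exchange_big /=.
transitivity (\sum_l (invmx A *m A) k l * pairing (form_zw (om l) p) v).
  rewrite mulVmx // (bigD1 k) //= big1 ?addr0 => [|l lk]; rewrite mxE ?eqxx ?mul1r //.
  by rewrite eq_sym (negPf lk) mul0r.
apply: eq_bigr => l _; rewrite mxE mulr_suml.
by apply: eq_bigr => j _; rewrite mulrA.
Qed.

End Basis.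

(** * The grid of the staircase polygon *)

Section Grid.
Variables (R : realType) (g : nat) (P : nat -> rect R).
Local Notation C := (Cplx R).
Hypothesis g2 : (2 <= g)%N.
Hypothesis shP : polygon_shape g P.

(** The rectangles of a column have the same vertical sides, those of a row the
    same horizontal sides: [g + 1] abscissas and [g + 1] ordinates describe the
    whole chain ([chainE]). *)
Definition colX (k : nat) : R :=
  if (k < g)%N then xl (chain g P k.*2) else xr (chain g P g.-1.*2).
Definition rowY (k : nat) : R :=
  if (k < g)%N then yb (chain g P k.*2.-1) else yt (chain g P g.-1.*2).

Lemma chain_nondegenerate m : (m < nchain g)%N -> Defs.nondegenerate (chain g P m).
Proof.
rewrite /nchain /chain => mg; case: shP => nd _ _ _; case: ifP => h.
  have [h1 h2] := nd (g.-1 - m)%N ltac:(lia).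
  by rewrite /Q /reflect_rect /Defs.nondegenerate /=; lra.
by apply: nd; lia.
Qed.

Lemma chain_left m : (m.*2.+2 < nchain g)%N ->
  Defs.left_of (chain g P m.*2.+1) (chain g P m.*2.+2).
Proof.
by move=> h; have := chain_adjacent g2 shP h; rewrite /= odd_double.
Qed.

Lemma chain_below m : (m.*2.+1 < nchain g)%N ->
  below (chain g P m.*2) (chain g P m.*2.+1).
Proof.
by move=> h; have := chain_adjacent g2 shP h; rewrite odd_double.
Qed.

Lemma chain_even k : (k < g)%N ->
  chain g P k.*2 = Rect (colX k) (colX k.+1) (rowY k) (rowY k.+1).
Proof.
move=> kg; rewrite /colX /rowY kg.
have Eyb : yb (chain g P k.*2) = yb (chain g P k.*2.-1).
  case: k kg => // k kg; rewrite doubleS /=.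
  by have [_ -> _] := @chain_left k ltac:(rewrite /nchain; lia).
rewrite -Eyb; case: ltnP => kg'; last first.
  by rewrite (_ : g.-1 = k); [case: (chain _ _ _)|lia].
have [e1 e2 e3] := @chain_below k ltac:(rewrite /nchain; lia).
have [e4 _ _] := @chain_left k ltac:(rewrite /nchain; lia).
by rewrite doubleS /= -e4 -e3 -e1; case: (chain _ _ _).
Qed.

Lemma chain_odd k : (k.+1 < g)%N ->
  chain g P k.*2.+1 = Rect (colX k) (colX k.+1) (rowY k.+1) (rowY k.+2).
Proof.
move=> kg.
have [e1 e2 e3] := @chain_below k ltac:(rewrite /nchain; lia).
have [e4 e5 e6] := @chain_left k ltac:(rewrite /nchain; lia).
move: e1 e2 e3 e4 e5 e6; rewrite -doubleS !chain_even //; last lia.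
by case: (chain _ _ _) => u v b t /= <- <- <- _ _ ->.
Qed.

Lemma colX_lt k : (k < g)%N -> colX k < colX k.+1.
Proof.
move=> kg; have [] := @chain_nondegenerate k.*2 ltac:(rewrite /nchain; lia).
by rewrite chain_even.
Qed.

Lemma rowY_lt k : (k < g)%N -> rowY k < rowY k.+1.
Proof.
move=> kg; have [] := @chain_nondegenerate k.*2 ltac:(rewrite /nchain; lia).
by rewrite chain_even.
Qed.

Lemma colX_le m n : (m <= n)%N -> (n <= g)%N -> colX m <= colX n.
Proof.
elim: n => [|n IH]; first by rewrite leqn0 => /eqP ->.
rewrite leq_eqVlt => /predU1P[-> //|mn] ng.
by rewrite (le_trans (IH mn (ltnW ng))) // ltW // colX_lt.
Qed.

Lemma rowY_le m n : (m <= n)%N -> (n <= g)%N -> rowY m <= rowY n.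
Proof.
elim: n => [|n IH]; first by rewrite leqn0 => /eqP ->.
rewrite leq_eqVlt => /predU1P[-> //|mn] ng.
by rewrite (le_trans (IH mn (ltnW ng))) // ltW // rowY_lt.
Qed.

Lemma rowY_gap k i y : (k < g)%N -> (i <= g)%N ->
  rowY k < y < rowY k.+1 -> y <> rowY i.
Proof.
move=> kg ig /andP[h1 h2] e; case: (leqP i k) => ik.
  by have {ik} := rowY_le ik (ltnW kg); lra.
by have := rowY_le ik ig; lra.
Qed.

Lemma colX_gap k i x : (k < g)%N -> (i <= g)%N ->
  colX k < x < colX k.+1 -> x <> colX i.
Proof.
move=> kg ig /andP[h1 h2] e; case: (leqP i k) => ik.
  by have {ik} := colX_le ik (ltnW kg); lra.
by have := colX_le ik ig; lra.
Qed.

Lemma rowY_inj k i y : (k < g)%N -> (i < g)%N ->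
  rowY k < y < rowY k.+1 -> rowY i <= y <= rowY i.+1 -> i = k.
Proof.
move=> kg ig /andP[h1 h2] /andP[h3 h4]; case: (ssrnat.ltngtP i k) => // ik; exfalso.
  by have {ik} := rowY_le ik (ltnW kg); lra.
by have := rowY_le ik (ltnW ig); lra.
Qed.

Lemma colX_inj k i x : (k < g)%N -> (i < g)%N ->
  colX k < x < colX k.+1 -> colX i <= x <= colX i.+1 -> i = k.
Proof.
move=> kg ig /andP[h1 h2] /andP[h3 h4]; case: (ssrnat.ltngtP i k) => // ik; exfalso.
  by have {ik} := colX_le ik (ltnW kg); lra.
by have := colX_le ik (ltnW ig); lra.
Qed.

Lemma chainE m : (m < nchain g)%N ->
  chain g P m = Rect (colX m./2) (colX m./2.+1) (rowY (uphalf m)) (rowY (uphalf m).+1).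
Proof.
rewrite /nchain => mg; case: (boolP (odd m)) => om.
  rewrite -[in LHS](odd_double_half m) om add1n chain_odd; last lia.
  by rewrite uphalf_half om.
rewrite -[in LHS](odd_double_half m) (negPf om) add0n chain_even; last lia.
by rewrite uphalf_half (negPf om).
Qed.

Lemma row_leftE k : (k < g)%N -> xl (row_left g P k) = colX k.-1 /\
   yb (row_left g P k) = rowY k /\ yt (row_left g P k) = rowY k.+1.
Proof.
move=> kg; rewrite /row_left chainE; last by rewrite /nchain; lia.
rewrite /= (_ : uphalf k.*2.-1 = k); last lia.
by rewrite (_ : k.*2.-1./2 = k.-1); last lia.
Qed.

Lemma row_rightE k : (k < g)%N -> xr (row_right g P k) = colX k.+1.
Proof. by move=> kg; rewrite /row_right chain_even. Qed.

Lemma col_bottomE k : (k < g)%N -> yb (col_bottom g P k) = rowY k /\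
   xl (col_bottom g P k) = colX k /\ xr (col_bottom g P k) = colX k.+1.
Proof. by move=> kg; rewrite /col_bottom chain_even. Qed.

Lemma col_topE k : (k < g)%N -> yt (col_top g P k) = rowY (minn k.+2 g).
Proof.
move=> kg; rewrite /col_top chainE /=; last by rewrite /nchain; lia.
by congr rowY; lia.
Qed.

(** Every chain of identifications starting at [s] begins with a step from or to
    [s]. *)
Lemma glued_isolated s t : glued g P s t ->
  (forall r, ~ glue_step g P s r /\ ~ glue_step g P r s) -> t = s.
Proof.
move=> st; pose iso s := forall r, ~ glue_step g P s r /\ ~ glue_step g P r s.
suff [] : (iso s -> t = s) /\ (iso t -> s = t) by [].
elim: st => {s t} [s t st|s|s t _ [h1 h2]|s t r _ [h1 h2] _ [h3 h4]].
- by split=> h; [have [] := h t|have [] := h s].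
- by [].
- by [].
split=> h; first by have e := h1 h; rewrite -[RHS]e; apply: h3; rewrite e.
by have e := h4 h; rewrite -[RHS]e; apply: h2; rewrite e.
Qed.

Lemma row_polygon k x y : (k < g)%N -> rowY k <= y <= rowY k.+1 ->
  colX k.-1 <= x <= colX k.+1 -> polygon g P (mkC x y).
Proof.
move=> kg hy /andP[h1 h2]; have [xk|kx] := leP (colX k) x.
  exists k.*2; first by rewrite /nchain; lia.
  by rewrite chain_even //; split; rewrite /reC /imC /= ?xk.
exists k.*2.-1; first by rewrite /nchain; lia.
rewrite chainE; last by rewrite /nchain; lia.
rewrite (_ : uphalf k.*2.-1 = k); last lia.
rewrite (_ : k.*2.-1./2 = k.-1); last lia.
split; rewrite /reC /imC //= h1 /=; case: k {kg hy h2} kx h1 => [|k] /=.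
  by move=> ? ?; lra.
by move=> /ltW.
Qed.

Lemma col_polygon k x y : (k < g)%N -> colX k <= x <= colX k.+1 ->
  rowY k <= y <= rowY (minn k.+2 g) -> polygon g P (mkC x y).
Proof.
move=> kg hx /andP[h1 h2]; have [yk|ky] := leP y (rowY k.+1).
  exists k.*2; first by rewrite /nchain; lia.
  by rewrite chain_even //; split; rewrite /reC /imC /= ?h1 ?yk.
have kg' : (k.+1 < g)%N.
  by rewrite ltnNge; apply/negP => gk; move: h2; rewrite (_ : minn _ _ = k.+1); [lra|lia].
exists k.*2.+1; first by rewrite /nchain; lia.
rewrite chain_odd //; split; rewrite /reC /imC //= ltW //=.
by move: h2; rewrite (_ : minn _ _ = k.+2); last lia.
Qed.

Lemma row_not_vertex k x y : (k < g)%N -> rowY k < y < rowY k.+1 ->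
  ~ vertex g P (mkC x y).
Proof.
move=> kg hy [m mg [_]]; rewrite chainE // /imC /=.
move: mg; rewrite /nchain => mg.
by case; apply: (rowY_gap kg _ hy); lia.
Qed.

Lemma col_not_vertex k x y : (k < g)%N -> colX k < x < colX k.+1 ->
  ~ vertex g P (mkC x y).
Proof.
move=> kg hx [m mg [+ _]]; rewrite chainE // /reC /=.
move: mg; rewrite /nchain => mg.
by case; apply: (colX_gap kg _ hx); lia.
Qed.

Lemma mkCD (x y x' y' : R) : mkC x y + mkC x' y' = mkC (x + x') (y + y').
Proof. by []. Qed.

(** Identifications happen on grid lines, and a horizontal line through centers
    lies on none of them; only its ends are on the sides of its row. *)
Lemma row_isolated k x y r : (k < g)%N -> rowY k < y < rowY k.+1 ->
  colX k.-1 < x < colX k.+1 ->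
  ~ glue_step g P (mkC x y) r /\ ~ glue_step g P r (mkC x y).
Proof.
move=> kg hy /andP[hx1 hx2]; split=> -[i ig []] [].
- have [-> [-> ->]] := row_leftE ig; rewrite /reC /imC /= => ex /(rowY_inj kg ig hy) ik.
  by move: hx1; rewrite ex ik ltxx.
- have [-> _] := col_bottomE ig; rewrite /imC /= => ey _ _.
  by apply: (rowY_gap kg _ hy) ey; lia.
- case: r => rx ry; have [-> [-> ->]] := row_leftE ig; rewrite row_rightE //.
  rewrite /reC /imC /= => -> h; rewrite mkCD => -[ex ey].
  have ik : i = k by apply: (rowY_inj kg ig hy); move: h; rewrite ey addr0.
  by move: hx2; rewrite ex ik; lra.
- case: r => rx ry; have [-> [-> ->]] := col_bottomE ig; rewrite col_topE //.
  rewrite /reC /imC /= => -> _; rewrite mkCD => -[_ ey].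
  by apply: (@rowY_gap k (minn i.+2 g) y kg _ hy); [lia|rewrite ey; ring].
Qed.

Lemma col_isolated k x y r : (k < g)%N -> colX k < x < colX k.+1 ->
  rowY k < y < rowY (minn k.+2 g) ->
  ~ glue_step g P (mkC x y) r /\ ~ glue_step g P r (mkC x y).
Proof.
move=> kg hx /andP[hy1 hy2]; split=> -[i ig []] [].
- have [-> _] := row_leftE ig; rewrite /reC /= => ex _ _.
  by apply: (colX_gap kg _ hx) ex; lia.
- have [-> [-> ->]] := col_bottomE ig; rewrite /reC /imC /= => ey /(colX_inj kg ig hx) ik.
  by move: hy1; rewrite ey ik ltxx.
- case: r => rx ry; have [-> [-> ->]] := row_leftE ig; rewrite row_rightE //.
  rewrite /reC /imC /= => -> _; rewrite mkCD => -[ex _].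
  by apply: (@colX_gap k i.+1 x kg _ hx); [lia|rewrite ex; ring].
- case: r => rx ry; have [-> [-> ->]] := col_bottomE ig; rewrite col_topE //.
  rewrite /reC /imC /= => -> h; rewrite mkCD => -[ex ey].
  have ik : i = k by apply: (colX_inj kg ig hx); move: h; rewrite ex addr0.
  by move: hy2; rewrite ey ik; lra.
Qed.

End Grid.

(** * Holomorphic functions along real lines *)

Section ComplexLine.
Variable R : realType.
Local Notation C := (Cplx R).

Lemma gt0_complex (e : C) : 0 < e -> exists2 r : R, 0 < r & e = toC r.
Proof.
case: e => u v e0; have : 0 < u +i* v := e0.
by rewrite ltcE /= => /andP[/eqP -> u0]; exists u.
Qed.

Lemma toC_continuous : continuous (@toC R : R -> C).
Proof.
move=> x; apply/cvgrPdist_lt => e /gt0_complex[r r0 ->].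
near=> y; rewrite /toC -rmorphB normc_def /= expr0n /= addr0 sqrtr_sqr ltcR.
by near: y; move: r r0; apply/cvgrPdist_lt.
Unshelve. all: by end_near. Qed.

Lemma normr_reC (z : C) : toC `|reC z| <= `|z|.
Proof. exact: normc_ge_Re. Qed.

Lemma normr_imC (z : C) : toC `|imC z| <= `|z|.
Proof.
case: z => u v; rewrite [leRHS](normc_def (u +i* v)%C) /toC lecR /imC /=.
by rewrite -sqrtr_sqr ler_wsqrtr // lerDr sqr_ge0.
Qed.

Lemma reC_continuous : continuous (@reC R : C -> R).
Proof.
move=> x; apply/(@cvgrPdist_lt _ _ _ (nbhs (x : C)) (nbhs_filter (x : C))) => e e0.
have e0' : 0 < toC e :> C by rewrite ltcR.
apply: filterS (@near_ball _ C x (toC e) e0') => y xy.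
have xy' : `|x - y| < toC e by exact: xy.
have := le_lt_trans (normr_reC (x - y)) xy'; rewrite /toC ltcR.
by case: x y {xy xy'} => ? ? [? ?].
Qed.

Lemma imC_continuous : continuous (@imC R : C -> R).
Proof.
move=> x; apply/(@cvgrPdist_lt _ _ _ (nbhs (x : C)) (nbhs_filter (x : C))) => e e0.
have e0' : 0 < toC e :> C by rewrite ltcR.
apply: filterS (@near_ball _ C x (toC e) e0') => y xy.
have xy' : `|x - y| < toC e by exact: xy.
have := le_lt_trans (normr_imC (x - y)) xy'; rewrite /toC ltcR.
by case: x y {xy xy'} => ? ? [? ?].
Qed.

Lemma toC_dnbhs : (@toC R : R -> C) @ 0^' --> (0 : C)^'.
Proof.
move=> A hA.
have hU : nbhs (0 : C) [set z | z != 0 -> A z] by exact: hA.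
have h : nbhs (0 : R) (@toC R @^-1` [set z | z != 0 -> A z]).
  apply: (@toC_continuous 0); have -> : toC (0 : R) = 0 by exact: rmorph0.
  exact: hU.
apply: (@filterS _ _ (nbhs_filter (0 : R))) h => y /= h y0; apply: h.
by rewrite fmorph_eq0.
Qed.

(** What [reC] and [imC] have in common, to differentiate both at once. *)
Definition real_linear (part : C -> R) : Prop :=
  [/\ continuous part, forall (h : R) z, part (toC h * z) = h * part z
    & forall z w, part (z - w) = part z - part w].

Lemma reC_linear : real_linear (@reC R).
Proof.
split; first exact: reC_continuous.
- by move=> h [x y]; rewrite /reC /toC /=; ring.
- by move=> [? ?] [? ?].
Qed.

Lemma imC_linear : real_linear (@imC R).
Proof.
split; first exact: imC_continuous.
- by move=> h [x y]; rewrite /imC /toC /=; ring.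
- by move=> [? ?] [? ?].
Qed.

Lemma eq0_reim (z : C) : reC z = 0 -> imC z = 0 -> z = 0.
Proof. by case: z => x y; rewrite /reC /imC /= => -> ->. Qed.

Lemma eta_complex (z : C) : mkC (reC z) (imC z) = z.
Proof. by case: z. Qed.

Lemma toC_double (x : R) : toC (2 * x) = 2 * toC x.
Proof. by rewrite /toC rmorphM /= rmorphMn /= rmorph1. Qed.

(** A complex derivative is a limit along all complex increments, in particular
    along the increments [h * d] with [h] real. *)
Lemma is_derive_line (F : C -> C) (L : R -> C) (d : C) (t : R) (part : C -> R) :
  real_linear part ->
  (forall h, L (h + t) = toC h * d + L t) ->
  derivable F (L t) 1 ->
  is_derive t 1 (part \o F \o L) (part (d * derive1 F (L t))).
Proof.
move=> [cpart partZ partB] LE dF.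
have difF : differentiable F (L t) by apply/derivable1_diffP.
have dFd : derivable F (L t) d by exact: diff_derivable.
have dE : 'D_d F (L t) = d * derive1 F (L t).
  rewrite (deriveE d difF) derive1E (deriveE (1 : C) difF).
  transitivity (d *: 'd F (L t) (1 : C)); last by [].
  rewrite -linearZ; congr ('d F (L t) _).
  by rewrite -[LHS]mulr1.
have key : (fun h : R => h^-1 *: ((part \o F \o L) (h *: 1 + t) - (part \o F \o L) t))
    @ 0^' --> part (d * derive1 F (L t)).
  have c1 := cvg_comp _ _ toC_dnbhs dFd.
  rewrite -[X in part X]dE.
  have := cvg_comp _ _ c1 (cpart _).
  apply: cvg_trans; apply: near_eq_cvg; apply: nearW => h /=.
  rewrite -[h *: 1]/(h * 1) mulr1 LE.
  rewrite -[_ *: d]/(toC h * d) -[_^-1 *: (_ - _)]/((toC h)^-1 * _).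
  by rewrite -[(toC h)^-1]fmorphV partZ partB.
apply: DeriveDef; first by apply/cvg_ex; eexists; exact: key.
exact: cvg_lim key.
Qed.

End ComplexLine.

(** * Trajectories in the polygon *)

Section Trajectory.
Variables (R : realType) (g : nat) (a : nat -> R) (P : nat -> rect R).
Variables (Phi : Cplx R -> one_point_compactification (Cplx R * Cplx R)) (c : R).
Local Notation C := (Cplx R).
Hypothesis g2 : (2 <= g)%N.
Hypothesis a1 : 1 < a 1%N.
Hypothesis incr_a : forall j : nat, (1 <= j)%N -> (j.+1 < g)%N -> a j < a j.+1.
Hypothesis c0 : 0 < c.
Hypothesis bi : biholomorphic_identification g a P Phi c.

(** The form [dz / w] vanishes at infinity, so that only the vertices go there. *)
Lemma affine_chart (s : C) : polygon g P s -> ~ vertex g P s ->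
  exists (phi : C -> one_point_compactification (C * C)) (p : C * C),
  [/\ Phi s = Some p, plane_curve (fz g a) p,
      \forall zeta \near s, polygon g P zeta -> phi zeta = Phi zeta,
      derivable (@coord_z R \o phi) s 1 /\ derivable (@coord_w R \o phi) s 1
    & toC c * pairing (du_over_v (fz g a) p)
        (derive1 (@coord_z R \o phi) s, derive1 (@coord_w R \o phi) s) = 1].
Proof.
move=> ps vs; have [_ surj _ /(_ s ps vs)[phi tc hol]] := bi.
have near_phi : \forall zeta \near s, polygon g P zeta -> phi zeta = Phi zeta.
  apply: filterS tc => zeta h pz.
  have := h s ps (Relation_Operators.rst_refl _ _ _).
  by rewrite subrr addr0; exact.
have phis : phi s = Phi s by exact: (nbhs_singleton near_phi).
have [[_ dphi] unit] := nbhs_singleton hol.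
have surf : surface g a (Phi s) by rewrite -surj; exists s.
exists phi; case E : (Phi s) => [p|].
  exists p; move: dphi unit surf; rewrite /pull phis E => dphi unit surf.
  by split.
move: unit; rewrite /pull phis E /pairing /= expr0n.
rewrite (_ : (g.-1 == 0)%N = false); last by case: (g) g2 => [|[]].
by rewrite oppr0 !mul0r addr0 mulr0 => /esym/eqP; rewrite oner_eq0.
Qed.

Variables (L : R -> C) (d : C) (s e : R).
Hypothesis se : s < e.
Hypothesis hL : forall h t, L (h + t) = toC h * d + L t.
Hypothesis d0 : d != 0.
Hypothesis polL : forall t, s <= t <= e -> polygon g P (L t) /\ ~ vertex g P (L t).

(** The functions [z] and [w] along [L]; by [line_ode], [w] is the velocity up to
    a constant factor. *)
Definition pos (t : R) : C := coord_z (Phi (L t)).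
Definition vel (t : R) : C := coord_w (Phi (L t)).

Lemma pos_vel t : s <= t <= e ->
  Phi (L t) = Some (pos t, vel t) /\ vel t ^+ 2 = (fz g a).[pos t].
Proof.
move=> /polL[pt vt]; have [phi [[z w] [E cp _ _ _]]] := affine_chart pt vt.
by rewrite /pos /vel E.
Qed.

Lemma line_continuous : continuous L.
Proof.
have -> : L = (fun t => toC t * d + L 0) by apply/funext => t; rewrite -hL addr0.
move=> t; apply: cvgD; last exact: cvg_cst.
by apply: cvgM; [exact: toC_continuous|exact: cvg_cst].
Qed.

(** By the equation [w^2 = f(z)] the derivatives form a tangent vector, and a
    tangent vector is determined by the value of [dz / w], here [1 / c]. *)
Lemma line_ode t : s < t < e ->
  exists Z W : C -> C, [/\ derivable Z (L t) 1, derivable W (L t) 1,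
    \forall r \near t, Z (L r) = pos r /\ W (L r) = vel r,
    derive1 Z (L t) = vel t / toC c
  & derive1 W (L t) *+ 2 = (fz g a)^`().[pos t] / toC c].
Proof.
move=> /andP[st te]; have tse : s <= t <= e by rewrite !ltW.
have [pt vt] := polL tse.
have [phi [p [E cp nphi [dZ dW] unit]]] := affine_chart pt vt.
pose Z := @coord_z R \o phi; pose W := @coord_w R \o phi.
have nr : \forall r \near t, s < r < e.
  have : t \in `]s, e[ by rewrite in_itv /= st te.
  by move=> /near_in_itvoo; apply: filterS => r; rewrite in_itv.
have nZW : \forall r \near t, Z (L r) = pos r /\ W (L r) = vel r.
  have nphi' : \forall r \near t, polygon g P (L r) -> phi (L r) = Phi (L r).
    exact: line_continuous nphi.
  apply: filterS2 nphi' nr => r h /andP[sr re].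
  have [pr _] := polL (introT andP (conj (ltW sr) (ltW re))).
  by rewrite /Z /W /= h.
have [Zt Wt] := nbhs_singleton nZW.
have pE : p = (pos t, vel t) by rewrite /pos /vel E; case: (p).
have c0' : toC c != 0 by rewrite fmorph_eq0 gt_eqF.
(* [G] vanishes along [L]; hence so does its complex derivative. *)
pose G := fun zeta => W zeta * W zeta - (fz g a).[Z zeta].
have dG : is_derive (L t) (1 : C) G
   (W (L t) * derive1 W (L t) + W (L t) * derive1 W (L t) -
    (fz g a)^`().[Z (L t)] * derive1 Z (L t)).
  apply: is_deriveB; last exact: is_derive_horner (is_derive_derive1 dZ).
  exact: is_deriveM (is_derive_derive1 dW) (is_derive_derive1 dW).
have [dG1 G'E] := dG.
have nG : \forall r \near t, G (L r) = 0.
  apply: filterS2 nZW nr => r [Zr Wr] /andP[sr re].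
  have [_ curve] := pos_vel (introT andP (conj (ltW sr) (ltW re))).
  by rewrite /G Zr Wr -expr2 curve subrr.
have part0 (part : C -> R) : part 0 = 0 -> real_linear part ->
    part (d * derive1 G (L t)) = 0.
  move=> p0 lin; have [_ <-] := is_derive_line lin (fun h => hL h t) dG1.
  rewrite -[RHS](@derive_val _ _ _ _ _ _ _ (is_derive_cst (0 : R) t 1)).
  by apply: near_eq_derive; apply: filterS nG => r /= ->.
have G'0 : derive1 G (L t) = 0.
  apply: (mulfI d0); rewrite mulr0; apply: eq0_reim; apply: part0 => //.
    exact: reC_linear.
  exact: imC_linear.
have tang : tangent (fz g a) p (derive1 Z (L t), derive1 W (L t)).
  move: G'0; rewrite derive1E G'E pE Zt Wt /tangent /= => /eqP.
  by rewrite subr_eq0 -mulr2n => /eqP.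
have smooth : (fz g a)^`().[p.1] != 0 \/ p.2 != 0.
  apply/orP; rewrite -negb_and; apply/negP => /andP[/eqP f0 /eqP w0].
  move: unit; rewrite /pairing /du_over_v w0 eqxx f0 invr0 !(mulr0, mul0r) addr0 mulr0.
  by move=> /esym/eqP; rewrite oner_eq0.
have [e1 e2] := du_over_v_tangent cp tang smooth.
have {}unit : pairing (du_over_v (fz g a) p) (derive1 Z (L t), derive1 W (L t)) = (toC c)^-1.
  by apply: (mulfI c0'); rewrite unit mulfV.
move: e1 e2; rewrite unit pE /= => e1 e2.
exists Z, W; split; [exact: dZ|exact: dW|exact: nZW|by rewrite -e1 mulrC|by rewrite -e2 mulrC].
Qed.

(** Composition with [clamp] turns a function that is only controlled on [s, e]
    into one that is continuous on the whole line and unchanged on [s, e]. *)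
Definition clamp (t : R) : R := Num.max s (Num.min t e).

Lemma clamp_in t : s <= clamp t <= e.
Proof. by rewrite /clamp le_max lexx /= ge_max (ltW se) /= ge_min lexx orbT. Qed.

Lemma clamp_id t : s <= t <= e -> clamp t = t.
Proof. by move=> /andP[st te]; rewrite /clamp (min_idPl te) (max_idPr st). Qed.

Lemma clamp_continuous : continuous clamp.
Proof.
move=> t; apply: (@continuous_max R R (fun=> s) (fun t => Num.min t e)).
  exact: cvg_cst.
apply: (@continuous_min R R id (fun=> e)); [exact: cvg_id|exact: cvg_cst].
Qed.

Lemma near_clamp t : s < t < e -> \forall r \near t, clamp r = r.
Proof.
move=> ht; have : t \in `]s, e[ by rewrite in_itv.
move=> /near_in_itvoo; apply: filterS => r; rewrite in_itv /= => /andP[h1 h2].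
by rewrite clamp_id // !ltW.
Qed.

Lemma clamped_continuous :
  continuous (pos \o clamp : R -> C) /\ continuous (vel \o clamp : R -> C).
Proof.
have gen (co : one_point_compactification (C * C) -> C) :
    (forall (phi : C -> one_point_compactification (C * C)) s p,
      phi s = Some p -> derivable (@coord_z R \o phi) s 1 ->
      derivable (@coord_w R \o phi) s 1 -> derivable (co \o phi) s 1) ->
    continuous ((fun t => co (Phi (L t))) \o clamp : R -> C).
  move=> hco t.
  have [pt vt] := polL (clamp_in t).
  have [phi [p [E _ nphi [dZ dW] _]]] := affine_chart pt vt.
  have phiE : phi (L (clamp t)) = Some p.
    by rewrite -E; apply: (nbhs_singleton nphi).
  have cco : {for L (clamp t), continuous (co \o phi)}.
    apply: differentiable_continuous; apply/derivable1_diffP.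
    exact: hco phiE dZ dW.
  have cLc : {for t, continuous (L \o clamp)}.
    apply: continuous_comp; first exact: clamp_continuous.
    exact: line_continuous.
  have cc : {for t, continuous ((co \o phi) \o (L \o clamp))}.
    exact: continuous_comp cLc cco.
  have nr : \forall r \near t, polygon g P (L (clamp r)) -> phi (L (clamp r)) = Phi (L (clamp r)).
    exact: cLc nphi.
  rewrite /continuous_at /= -(nbhs_singleton nphi pt).
  apply: cvg_trans cc; apply: near_eq_cvg; apply: filterS nr => r /= -> //.
  by have [] := polL (clamp_in r).
by split; apply: gen.
Qed.

Lemma is_derive_pos_vel t (part : C -> R) : s < t < e -> real_linear part ->
  is_derive t 1 (part \o (pos \o clamp)) (part (d * (vel t / toC c))) /\
  is_derive t 1 (part \o (vel \o clamp)) (part (d * ((fz g a)^`().[pos t] / toC (2 * c)))).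
Proof.
move=> ht lin.
have [Z [W [dZ dW nZW Z' W']]] := line_ode ht.
have W'' : derive1 W (L t) = (fz g a)^`().[pos t] / toC (2 * c).
  have c0' : toC c != 0 by rewrite fmorph_eq0 gt_eqF.
  apply: (@mulfI _ (2 : C)); first by rewrite pnatr_eq0.
  transitivity (derive1 W (L t) *+ 2); first by rewrite mulr_natl.
  by rewrite W' toC_double; field; rewrite c0' ?pnatr_eq0.
have nc := near_clamp ht.
have h1 := is_derive_line lin (fun h => hL h t) dZ.
have h2 := is_derive_line lin (fun h => hL h t) dW.
rewrite -Z' -W''; split.
  apply: near_eq_is_derive h1; apply: filterS2 nZW nc => r [zr wr] cr /=.
  by rewrite cr zr.
apply: near_eq_is_derive h2; apply: filterS2 nZW nc => r [zr wr] cr /=.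
by rewrite cr wr.
Qed.

Lemma pull_pos (om : oneform R) t : s < t < e ->
  pull g (@real_derive R) om (fun t => Phi (L t)) t =
  pairing (form_zw om (pos t, vel t))
    (d * (vel t / toC c), d * ((fz g a)^`().[pos t] / toC (2 * c))).
Proof.
move=> ht; have tse : s <= t <= e by case/andP: ht => *; rewrite !ltW.
have [E _] := pos_vel tse.
rewrite /pull E; congr pairing.
have nc := near_clamp ht.
have der (part : C -> R) (q : R -> C) z : is_derive t 1 (part \o (q \o clamp)) z ->
    derive1 (part \o q) t = z.
  move=> [_ <-]; rewrite derive1E; apply: near_eq_derive.
  by apply: filterS nc => r /= ->.
have [re1 re2] := is_derive_pos_vel ht (@reC_linear R).
have [im1 im2] := is_derive_pos_vel ht (@imC_linear R).
congr (_, _); rewrite /real_derive.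
  by rewrite (der _ pos _ re1) (der _ pos _ im1) eta_complex.
by rewrite (der _ vel _ re2) (der _ vel _ im2) eta_complex.
Qed.

(** In the coordinate [zeta] the form [z^j dz / w] is [z^j d zeta / c]. *)
Lemma pull_basis (n : nat) (th : oneform R) (B : 'I_n -> C) t : s < t < e ->
  (forall p v, plane_curve (fz g a) p -> tangent (fz g a) p v ->
    pairing (form_zw th p) v =
       \sum_j B j * (p.1 ^+ j * pairing (du_over_v (fz g a) p) v)) ->
  pull g (@real_derive R) th (fun t => Phi (L t)) t =
  \sum_j B j * d / toC c * pos t ^+ j.
Proof.
move=> ht thE; have tse : s <= t <= e by case/andP: ht => *; rewrite !ltW.
have [E curve] := pos_vel tse.
have c0' : toC c != 0 by rewrite fmorph_eq0 gt_eqF.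
set v := (d * (vel t / toC c), d * ((fz g a)^`().[pos t] / toC (2 * c))).
have tang : tangent (fz g a) (pos t, vel t) v.
  by rewrite /tangent /= toC_double -mulr_natr; field; rewrite ?c0' ?pnatr_eq0.
have smooth : (fz g a)^`().[pos t] != 0 \/ vel t != 0.
  have [w0|] := eqVneq (vel t) 0; [left|by right].
  by apply: fz_simple => //; rewrite -curve w0 expr0n.
rewrite pull_pos // thE //=.
have -> : pairing (du_over_v (fz g a) (pos t, vel t)) v = d / toC c.
  have [e1 e2] := @du_over_v_tangent _ _ (pos t, vel t) v curve tang smooth.
  move: e1 e2; rewrite /= => e1 e2; case: smooth => nz; apply: (mulIf nz).
    by rewrite e2 toC_double -mulr_natr; field; rewrite c0' ?pnatr_eq0.
  by rewrite e1; field.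
by apply: eq_bigr => j _; ring.
Qed.

(** Both directions of the polygon have a real square. *)
Variable sg : R.
Hypothesis dsg : d ^+ 2 = toC sg.
Variables t0 b0 : R.
Hypothesis sOe : s < t0 < e.
Hypothesis posO : pos t0 = toC b0.
Hypothesis velO : vel t0 = 0.

Definition xcoord (t : R) : R := reC (pos (clamp t)).
Definition speed (t : R) : R := reC (d * (vel (clamp t) / toC c)).

Let clampO : clamp t0 = t0.
Proof. by apply: clamp_id; case/andP: sOe => *; rewrite !ltW. Qed.

Let toC_c : toC c != 0. Proof. by rewrite fmorph_eq0 gt_eqF. Qed.

Let mul_continuous (k : C) : continuous (fun z : C => d * (z / k)).
Proof.
rewrite (_ : (fun z : C => _) = ( *%R (d / k))); first exact: mulrl_continuous.
by apply/funext => z; ring.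
Qed.

Let is_derive_speed (part : C -> R) t : s < t < e -> real_linear part ->
  is_derive t 1 (fun t => part (d * (vel (clamp t) / toC c)))
    (sg / (2 * c ^+ 2) * part (fz g a)^`().[pos t]).
Proof.
move=> ht [cpart partZ partB].
pose part' z := part (d * (z / toC c)).
have lin' : real_linear part'.
  split=> [z|h z|z w]; last 2 first.
  - by rewrite /part' -partZ; congr part; ring.
  - by rewrite /part' -partB; congr part; ring.
  apply: (@continuous_comp _ _ _ (fun z : C => d * (z / toC c)) part).
    exact: mul_continuous.
  exact: cpart.
have [_ h] := is_derive_pos_vel ht lin'.
move: h; congr is_derive; rewrite /part' -partZ; congr part.
have -> : toC (sg / (2 * c ^+ 2)) = d ^+ 2 / (toC (2 * c) * toC c).
  rewrite dsg; apply: etrans (fmorph_div (@toC R) sg (2 * c ^+ 2)) _; congr (_ / _).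
  by apply: etrans (rmorphM (@toC R) _ _); rewrite expr2 mulrA.
by rewrite toC_double; field; rewrite toC_c ?pnatr_eq0.
Qed.

Let comp_continuous (f : R -> C) (p : C -> R) :
  continuous f -> continuous p -> continuous (fun t => p (f t)).
Proof. by move=> cf cp t; exact: (@continuous_comp _ _ _ f p t (cf t) (cp (f t))). Qed.

Let speedC_continuous (p : C -> R) : continuous p ->
  continuous (fun t => p (d * (vel (clamp t) / toC c))).
Proof.
move=> cp; have [_ cv] := clamped_continuous.
apply: (comp_continuous (p := fun z => p (d * (z / toC c))) cv) => z.
by apply: (@continuous_comp _ _ _ (fun z : C => d * (z / toC c)) p);
  [exact: mul_continuous|exact: cp].
Qed.

Lemma xcoord_continuous : continuous xcoord.
Proof.
have [cp _] := clamped_continuous.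
exact: comp_continuous cp (@reC_continuous R).
Qed.

Lemma speed_continuous : continuous speed.
Proof.
exact: speedC_continuous (@reC_continuous R).
Qed.

(** The equation [z'' = k f'(z)] has real coefficients for both directions. *)
Lemma trajectory_real t : s <= t <= e ->
  pos t = toC (xcoord t) /\ d * (vel t / toC c) = toC (speed t).
Proof.
move=> ht.
have [cp cv] := clamped_continuous.
have [] := @real_solution R (curve_poly g a)^`() (sg / (2 * c ^+ 2)) s e t0
  xcoord (fun t => imC (pos (clamp t))) (fun t => imC (d * (vel (clamp t) / toC c)))
  xcoord_continuous _ _ _ _ sOe _ _ t ht.
- exact: comp_continuous cp (@imC_continuous R).
- exact: speedC_continuous (@imC_continuous R).
- move=> r hr; have [h _] := is_derive_pos_vel hr (@imC_linear R).
  by rewrite clamp_id; [exact: h|case/andP: hr => *; rewrite !ltW].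
- move=> r hr; have := is_derive_speed hr (@imC_linear R).
  congr is_derive; rewrite /fz deriv_map; congr (_ * imC (horner _ _)).
  rewrite /xcoord clamp_id; last by case/andP: hr => *; rewrite !ltW.
  by case: (pos r).
- by rewrite clampO posO.
- by rewrite clampO velO mul0r mulr0.
rewrite /xcoord /speed clamp_id //.
by case: (pos t) (d * _) => [x y] [u v]; rewrite /imC /reC /toC /= => -> ->.
Qed.

Lemma trajectory_ode t : s < t < e ->
  is_derive t 1 xcoord (speed t) /\
  is_derive t 1 speed (sg / (2 * c ^+ 2) * (curve_poly g a)^`().[xcoord t]).
Proof.
move=> ht; have tse : s <= t <= e by case/andP: ht => *; rewrite !ltW.
split.
  have [h _] := is_derive_pos_vel ht (@reC_linear R).
  by rewrite /speed clamp_id.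
have := is_derive_speed ht (@reC_linear R); congr is_derive; congr (_ * _).
have [-> _] := trajectory_real tse.
by rewrite /fz deriv_map horner_map.
Qed.

(** The first integral of the equation. *)
Lemma trajectory_curve t : s <= t <= e ->
  speed t ^+ 2 = sg / c ^+ 2 * (curve_poly g a).[xcoord t].
Proof.
move=> ht; have [px vx] := trajectory_real ht.
have [_ curve] := pos_vel ht.
suff : toC (speed t ^+ 2) = toC (sg / c ^+ 2 * (curve_poly g a).[xcoord t]) by case.
have -> : toC (speed t ^+ 2) = toC (speed t) ^+ 2 by exact: (rmorphXn (@toC R) 2).
have -> : toC (sg / c ^+ 2 * (curve_poly g a).[xcoord t]) = d ^+ 2 / toC c ^+ 2 * (fz g a).[pos t].
  rewrite dsg px /fz horner_map; apply: etrans (rmorphM (@toC R) _ _) _; congr (_ * _).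
  apply: etrans (fmorph_div (@toC R) _ _) _; congr (_ / _).
  exact: (rmorphXn (@toC R) 2 c).
rewrite -vx -curve; field; exact: toC_c.
Qed.

End Trajectory.

(** * Periods along one line *)

Section SegmentIntegral.
Variables (R : realType) (g : nat) (a : nat -> R) (c : R).
Local Notation mu := (@lebesgue_measure R).
Hypothesis g2 : (2 <= g)%N.
Hypothesis c0 : 0 < c.

Lemma curve_poly_odd y : (curve_poly g a).[- y] = - (curve_poly g a).[y].
Proof.
rewrite curve_polyE // !hornerM !hornerX mulNr; congr (- (_ * _)).
rewrite !horner_prod; apply: eq_bigr => i _.
by rewrite !(hornerD, hornerN, hornerXn, hornerC) sqrrN.
Qed.

Lemma expr_comp_continuous (x : R -> R) (j : nat) :
  continuous x -> continuous (fun t => x t ^+ j).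
Proof.
move=> cx t; apply: (@continuous_comp _ _ _ x (fun y => y ^+ j)); first exact: cx.
exact: exprn_continuous.
Qed.

(** The velocity of the trajectory is [sqrt |f(x)| / c], so that the statement is
    the substitution [y = x t]; the sign of [x] makes the integrand nonnegative,
    as the passage to the limit requires. *)
Lemma segment_integral_pos (sg : R) (x v : R -> R) (S T : R) (j : nat) :
  `|sg| = 1 -> S < T ->
  continuous x -> continuous v ->
  (forall t, S < t < T -> is_derive t 1 x (v t)) ->
  (forall t, S < t < T -> 0 < v t) ->
  (forall t, S < t < T -> v t ^+ 2 = sg / c ^+ 2 * (curve_poly g a).[x t]) ->
  0 <= x S ->
  (\int[mu]_(t in `[S, T]) (x t ^+ j) = c * abs_integral g a j (x S) (x T))%R.
Proof.
move=> sg1 ST cx cv dx vpos curve xS.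
have sqrtE t : S < t < T -> Num.sqrt `|(curve_poly g a).[x t]| = c * v t.
  move=> ht; have cv0 : 0 <= c * v t by rewrite mulr_ge0 ?(ltW c0) // ltW ?vpos.
  have E : sg * (curve_poly g a).[x t] = (c * v t) ^+ 2.
    by rewrite exprMn curve //; field; rewrite gt_eqF.
  by rewrite -[X in Num.sqrt X]mul1r -sg1 -normrM E normrX sqrtr_sqr normr_id ger0_norm.
have cH y : x S < y < x T ->
    {for y, continuous (fun y : R => y ^+ j / Num.sqrt `|(curve_poly g a).[y]|)}.
  move=> /andP[h1 h2].
  have hy : Num.min (x S) (x T) <= y <= Num.max (x S) (x T).
    by rewrite ge_min le_max (ltW h1) (ltW h2) orbT.
  have [t] := @IVT R x S T y (ltW ST) (continuous_subspaceT cx) hy.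
  rewrite in_itv /= => /andP[St tT] xt.
  have ht : S < t < T.
    rewrite !lt_neqAle St tT !andbT.
    by apply/andP; split; apply/eqP => z; move: h1 h2; rewrite -xt z ltxx.
  apply: cvgM; first exact: exprn_continuous.
  apply: cvgV; first by rewrite -xt sqrtE // gt_eqF // mulr_gt0 // vpos.
  apply: (@continuous_comp _ _ _ (fun y => `|(curve_poly g a).[y]|) (@Num.sqrt R));
    last exact: sqrt_continuous.
  apply: (@continuous_comp _ _ _ (horner (curve_poly g a)) (fun y => `|y|)).
    exact: continuous_horner.
  exact: norm_continuous.
have cxj : continuous (fun t => x t ^+ j) by exact: expr_comp_continuous.
have := @integral_substitution_oo R (fun y => y ^+ j / Num.sqrt `|(curve_poly g a).[y]|)
   (fun t => x t ^+ j * c^-1) x v S T ST cx cv _ dx vpos cH _ _.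
rewrite /abs_integral => ->.
- rewrite RintegralZr //; last exact: integrable_segment.
  by rewrite mulrCA mulfV ?mulr1 // gt_eqF.
- by move=> t; apply: cvgM; [exact: cxj|exact: cvg_cst].
- move=> y /andP[h1 _]; rewrite divr_ge0 ?sqrtr_ge0 // exprn_ge0 //.
  by rewrite ltW // (le_lt_trans xS).
- by move=> t ht; rewrite sqrtE //; field; rewrite !gt_eqF // vpos.
Qed.

(** On the negative side, run the trajectory [- x] backwards. *)
Lemma segment_integral_neg (sg : R) (x v : R -> R) (S T : R) (j : nat) :
  `|sg| = 1 -> S < T ->
  continuous x -> continuous v ->
  (forall t, S < t < T -> is_derive t 1 x (v t)) ->
  (forall t, S < t < T -> 0 < v t) ->
  (forall t, S < t < T -> v t ^+ 2 = sg / c ^+ 2 * (curve_poly g a).[x t]) ->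
  x T <= 0 ->
  (\int[mu]_(t in `[S, T]) (x t ^+ j) = c * ((-1) ^+ j * abs_integral g a j (- x T) (- x S)))%R.
Proof.
move=> sg1 ST cx cv dx vpos curve xT.
have inST t : S < t < T -> S < S + T + (-1) * t < T by lra.
have cxj : continuous (fun t => x t ^+ j) by exact: expr_comp_continuous.
have sgN : `|- sg| = 1 by rewrite normrN.
have E : (\int[mu]_(t in `[S, T]) ((- x (S + T + (-1) * t)) ^+ j) =
          c * abs_integral g a j (- x T) (- x S))%R.
  have := @segment_integral_pos (- sg) (fun t => - x (S + T + (-1) * t))
     (fun t => v (S + T + (-1) * t)) S T j sgN ST.
  rewrite (_ : S + T + (-1) * S = T); last by ring.
  rewrite (_ : S + T + (-1) * T = S); last by ring.
  apply.
  - by move=> t; apply: cvgN; exact: continuous_affine.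
  - exact: continuous_affine.
  - move=> t ht; have := is_deriveN (is_derive_affine (dx _ (inST t ht))).
    by move=> /is_derive_eq; apply; ring.
  - by move=> t ht; apply/vpos/inST.
  - move=> t ht; rewrite curve_poly_odd curve; last exact: inST.
    by ring.
  - by rewrite oppr_ge0.
rewrite mulrCA -E.
have := @Rintegral_flip R (fun t => x t ^+ j) (S + T) S T cxj (ltW ST).
rewrite (_ : S + T - T = S); last by ring.
rewrite (_ : S + T - S = T); last by ring.
move=> ->.
have -> : (fun t => (- x (S + T + -1 * t)) ^+ j) = (fun t => (-1) ^+ j * (x (S + T - t)) ^+ j).
  apply/funext => t; rewrite (_ : S + T + -1 * t = S + T - t); last by ring.
  exact: exprNn.
rewrite RintegralZl //; first by rewrite mulrA -exprMn mulrNN mulr1 expr1n mul1r.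
apply: integrable_segment.
rewrite (_ : (fun t => _) = (fun t => x (S + T + -1 * t) ^+ j)).
  exact: (@continuous_affine _ (fun t => x t ^+ j)).
by apply/funext => t; rewrite mulN1r.
Qed.

End SegmentIntegral.

Section ComplexIntegral.
Variable R : realType.
Local Notation C := (Cplx R).
Local Notation mu := (@lebesgue_measure R).

(** The measurability of [f] on the open interval is inherited from [f']. *)
Lemma Rintegral_eq_oo (f f' : R -> R) s e : continuous f' ->
  (forall t, s < t < e -> f t = f' t) ->
  (\int[mu]_(t in `[s, e]) f t = \int[mu]_(t in `[s, e]) f' t)%R.
Proof.
move=> cf' ff'; rewrite /Rintegral; congr fine.
have mf' : measurable_fun `]s, e[ (EFin \o f').
  by apply/measurable_EFinP; apply: measurable_funTS; exact: continuous_measurable_fun.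
rewrite integral_itv_bndoo; last first.
  apply: eq_measurable_fun mf' => t; rewrite inE /= in_itv /= => ht.
  by rewrite /= ff'.
rewrite [RHS]integral_itv_bndoo //.
by apply: eq_integral => t; rewrite inE /= in_itv /= => /ff' ->.
Qed.

Lemma continuous_lincomb (I : Type) (r : seq I) (k : I -> R) (y : I -> R -> R) :
  (forall j, continuous (y j)) -> continuous (fun t => \sum_(j <- r) k j * y j t).
Proof.
move=> cy; elim: r => [|j r IH].
  rewrite (_ : (fun t => _) = cst 0) => [t|]; first exact: cvg_cst.
  by apply/funext => t; rewrite big_nil.
rewrite (_ : (fun t => _) = (fun t => k j * y j t + \sum_(j <- r) k j * y j t)); last first.
  by apply/funext => t; rewrite big_cons.
by move=> t; apply: cvgD; [apply: cvgM; [exact: cvg_cst|exact: cy]|exact: IH].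
Qed.

Lemma Rintegral_lincomb (I : Type) (r : seq I) (k : I -> R) (y : I -> R -> R) s e :
  (forall j, continuous (y j)) ->
  (\int[mu]_(t in `[s, e]) (\sum_(j <- r) k j * y j t) =
   \sum_(j <- r) k j * \int[mu]_(t in `[s, e]) y j t)%R.
Proof.
move=> cy; elim: r => [|j r IH].
  rewrite big_nil; under eq_Rintegral do rewrite big_nil.
  by rewrite Rintegral_cst // mul0r.
rewrite big_cons -IH; under eq_Rintegral do rewrite big_cons.
have ckj : continuous (fun t => k j * y j t).
  by move=> t; apply: cvgM; [exact: cvg_cst|exact: cy].
rewrite RintegralD //; last 2 first.
  exact: integrable_segment.
  by apply: integrable_segment; exact: continuous_lincomb.
by rewrite RintegralZl //; exact: integrable_segment.
Qed.

Lemma reC_sum (n : nat) (F : 'I_n -> C) : reC (\sum_j F j) = \sum_j reC (F j).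
Proof. by apply: big_morph => [[? ?] [? ?]|]. Qed.

Lemma imC_sum (n : nat) (F : 'I_n -> C) : imC (\sum_j F j) = \sum_j imC (F j).
Proof. by apply: big_morph => [[? ?] [? ?]|]. Qed.

Lemma reC_mulr (z : C) x : reC (z * toC x) = reC z * x.
Proof. by case: z => u v; rewrite /reC /toC /=; ring. Qed.

Lemma imC_mulr (z : C) x : imC (z * toC x) = imC z * x.
Proof. by case: z => u v; rewrite /imC /toC /=; ring. Qed.

Lemma cintegral_lincomb (n : nat) (k : 'I_n -> C) (y : 'I_n -> R -> R) (u : R -> C) s e :
  (forall j, continuous (y j)) ->
  (forall t, s < t < e -> u t = \sum_j k j * toC (y j t)) ->
  cintegral s e u = \sum_j k j * toC (\int[mu]_(t in `[s, e]) y j t)%R.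
Proof.
move=> cy uE; rewrite /cintegral.
rewrite (@Rintegral_eq_oo _ (fun t => \sum_j reC (k j) * y j t)); last 2 first.
  exact: continuous_lincomb.
  by move=> t /uE ->; rewrite reC_sum; apply: eq_bigr => j _; rewrite reC_mulr.
rewrite (@Rintegral_eq_oo (fun t => imC (u t)) (fun t => \sum_j imC (k j) * y j t)); last 2 first.
  exact: continuous_lincomb.
  by move=> t /uE ->; rewrite imC_sum; apply: eq_bigr => j _; rewrite imC_mulr.
rewrite !Rintegral_lincomb //.
have eta (z : C) : z = mkC (reC z) (imC z) by case: z.
rewrite [RHS]eta reC_sum imC_sum; congr mkC; apply: eq_bigr => j _.
  by rewrite reC_mulr.
by rewrite imC_mulr.
Qed.

End ComplexIntegral.

Section LinePeriods.
Variables (R : realType) (g : nat) (a : nat -> R) (P : nat -> rect R).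
Variables (Phi : Cplx R -> one_point_compactification (Cplx R * Cplx R)) (c : R).
Local Notation C := (Cplx R).
Local Notation mu := (@lebesgue_measure R).
Hypothesis g2 : (2 <= g)%N.
Hypothesis a1 : 1 < a 1%N.
Hypothesis incr_a : forall j : nat, (1 <= j)%N -> (j.+1 < g)%N -> a j < a j.+1.
Hypothesis c0 : 0 < c.
Hypothesis bi : biholomorphic_identification g a P Phi c.

Variables (L : R -> C) (d : C) (s e sg : R).
Hypothesis hL : forall h t, L (h + t) = toC h * d + L t.
Hypothesis dsg : d ^+ 2 = toC sg.
Hypothesis sg1 : `|sg| = 1.
Hypothesis polL : forall t, s <= t <= e -> polygon g P (L t) /\ ~ vertex g P (L t).
Hypothesis injL : forall t t', s < t < e -> s <= t' <= e ->
  Phi (L t) = Phi (L t') -> t = t'.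

(** The integral of [x^j / sqrt |f|] over a segment on one side of 0, written on
    the positive side. *)
Definition signed_integral (j : nat) (b b' : R) : R :=
  if 0 <= b then abs_integral g a j b b'
  else (-1) ^+ j * abs_integral g a j (- b') (- b).

(** The trajectory along [L] is real and increases from [b] to [b'] between [S]
    and [T].  The rest of [s, e] consists of its reflections about [S] and [T],
    which double the integrals.  When [S = s] or [T = e], as in the first row and
    in the last column, there is only one reflection. *)
Lemma line_periods (S T b b' : R) :
  s <= S -> S < T -> T <= e -> e - s = 2 * (T - S) ->
  b < b' -> 0 <= b \/ b' <= 0 ->
  Phi (L S) = Some (toC b, 0) -> Phi (L T) = Some (toC b', 0) ->
  exists x : R -> R,
  [/\ continuous x,
      forall t, S < t < T -> b < x t < b',
      forall j, (\int[mu]_(t in `[S, T]) (x t ^+ j) = c * signed_integral j b b')%R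
    & forall (n : nat) (th : oneform R) (B : 'I_n -> C),
      (forall p v, plane_curve (fz g a) p -> tangent (fz g a) p v ->
        pairing (form_zw th p) v =
        \sum_j B j * (p.1 ^+ j * pairing (du_over_v (fz g a) p) v)) ->
      path_integral g th (Path s e (fun t => Phi (L t))) =
      \sum_j B j * (2 * d * toC (signed_integral j b b'))].
Proof.
move=> sS ST Te es bb' sgn PS PT.
have se : s < e by lra.
have d0 : d != 0.
  apply/eqP => z; move: dsg; rewrite z expr0n /= => /esym/eqP; rewrite fmorph_eq0 => /eqP z'.
  by move: sg1; rewrite z' normr0 => /eqP; rewrite eq_sym oner_eq0.
have velS : vel Phi L S = 0 by rewrite /vel PS.
have velT : vel Phi L T = 0 by rewrite /vel PT.
have posS : pos Phi L S = toC b by rewrite /pos PS.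
have posT : pos Phi L T = toC b' by rewrite /pos PT.
(* At least one of [S] and [T] is an interior point of [s, e]. *)
have [m [bm [sOe posO velO]]] : exists m bm, [/\ s < m < e, pos Phi L m = toC bm & vel Phi L m = 0].
  have [sS'|Ss] := ltP s S; first by exists S, b; split=> //; lra.
  by exists T, b'; split=> //; lra.
pose x := xcoord Phi L s e; pose v := speed Phi c L d s e.
have cx : continuous x := xcoord_continuous g2 bi se hL polL.
have cv : continuous v := speed_continuous g2 bi se hL polL.
have trueR := trajectory_real g2 c0 bi se hL d0 polL dsg sOe posO velO.
have odeR := trajectory_ode g2 c0 bi se hL d0 polL dsg sOe posO velO.
have curve := trajectory_curve g2 c0 bi se hL d0 polL dsg sOe posO velO.
have dx t : s < t < e -> is_derive t 1 x (v t) by move=> /odeR[].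
have dv t : s < t < e -> is_derive t 1 v (sg / (2 * c ^+ 2) * (curve_poly g a)^`().[x t]).
  by move=> /odeR[].
have toC_inj (r r' : R) : toC r = toC r' -> r = r' by move=> [].
have c0' : toC c != 0 by rewrite fmorph_eq0 gt_eqF.
have xS : x S = b by apply: toC_inj; have [<- _] := trueR S ltac:(lra).
have xT : x T = b' by apply: toC_inj; have [<- _] := trueR T ltac:(lra).
have v0 t : s <= t <= e -> vel Phi L t = 0 -> v t = 0.
  by move=> ht z; apply: toC_inj; have [_ <-] := trueR t ht; rewrite z mul0r mulr0.
have vS : v S = 0 by apply: v0 => //; lra.
have vT : v T = 0 by apply: v0 => //; lra.
have inj t t' : s < t < e -> s <= t' <= e -> x t = x t' -> v t = v t' -> t = t'.
  move=> ht ht' ex ev; apply: injL => //.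
  have tse : s <= t <= e by case/andP: ht => *; rewrite !ltW.
  have [-> _] := pos_vel g2 bi polL tse; have [-> _] := pos_vel g2 bi polL ht'.
  have [-> e1] := trueR t tse; have [-> e2] := trueR t' ht'.
  congr (Some (_, _)); first by congr toC; exact: ex.
  have : d * (vel Phi L t / toC c) = d * (vel Phi L t' / toC c).
    by rewrite e1 e2; congr toC; exact: ev.
  by move=> /(mulfI d0) /(mulIf (invr_neq0 c0')).
have xST : x S < x T by rewrite xS xT.
have vpos := velocity_pos cx cv dx dv inj sS ST Te vS vT xST.
have dxST t : S < t < T -> is_derive t 1 x (v t) by move=> ?; apply: dx; lra.
have curveST t : S < t < T -> v t ^+ 2 = sg / c ^+ 2 * (curve_poly g a).[x t].
  by move=> ?; apply: curve; lra.
have integ j : (\int[mu]_(t in `[S, T]) (x t ^+ j) = c * signed_integral j b b')%R.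
  rewrite /signed_integral -xS -xT; case: ifPn => [b0|/negbTE b0].
    exact: (segment_integral_pos c0 j sg1 ST cx cv dxST vpos curveST).
  apply: (segment_integral_neg g2 c0 j sg1 ST cx cv dxST vpos curveST).
  by case: sgn; rewrite -?xS -?xT // b0.
exists x; split=> //.
  move=> t /andP[St tT]; rewrite -xS -xT.
  have mono : {in `[S, T] &, {homo x : p q / p < q}}.
    apply: gtr0_derive1_lt_cc; last exact: continuous_subspaceT.
    - by move=> r; rewrite in_itv /= => /dxST [].
    - move=> r; rewrite in_itv /= => hr; rewrite derive1E.
      by have -> := @derive_val _ _ _ _ _ _ _ (dxST r hr); exact: vpos.
  by rewrite !mono // in_itv /= ?lexx ?(ltW St) ?(ltW tT) ?(ltW ST).
move=> n th B thE.
rewrite /path_integral /=.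
rewrite (@cintegral_lincomb R n (fun j => B j * d / toC c) (fun j t => x t ^+ j)); last 2 first.
- by move=> j; exact: expr_comp_continuous.
- move=> t ht; rewrite (pull_basis g2 a1 incr_a c0 bi hL d0 polL ht thE).
  apply: eq_bigr => j _; have [-> _] := trueR t ltac:(lra).
  by rewrite /x /toC rmorphXn.
apply: eq_bigr => j _.
have sym : forall O', s < O' < e -> v O' = 0 -> forall w, 0 <= w -> s <= O' - w -> O' + w <= e ->
    x (O' + w) ^+ j = x (O' - w) ^+ j.
  by move=> O' hO' vO' w w0 h1 h2; have [-> _] := reflect_solution cx cv dx dv hO' vO' w0 h1 h2.
rewrite (@Rintegral_fold R _ s e S T) //; last first.
- move=> w w0 hw; have [wz|wnz] := eqVneq w 0; first by rewrite wz addr0 subr0.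
  have : 0 < w by rewrite lt_neqAle eq_sym wnz.
  by move=> wpos; apply: sym; lra.
- move=> w w0 hw; have [wz|wnz] := eqVneq w 0; first by rewrite wz addr0 subr0.
  have : 0 < w by rewrite lt_neqAle eq_sym wnz.
  by move=> wpos; apply: sym; lra.
- exact: expr_comp_continuous.
rewrite integ.
have -> : toC (2 * (c * signed_integral j b b')) = 2 * (toC c * toC (signed_integral j b b')).
  by rewrite /toC !rmorphM /= rmorphMn /= rmorph1.
by field.
Qed.

End LinePeriods.

(** * Rows and columns *)

Section Branch.
Variables (R : realType) (g : nat) (a : nat -> R).
Hypothesis g2 : (2 <= g)%N.
Hypothesis a1 : 1 < a 1%N.
Hypothesis incr_a : forall j : nat, (1 <= j)%N -> (j.+1 < g)%N -> a j < a j.+1.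

(** The finite branch points in increasing order, from [- a_(g-1)] to [a_(g-1)]. *)
Definition branch (n : nat) : R := if (n <= g)%N then - bp a (g - n) else bp a (n - g).

Lemma branch_lt n : (n < g.*2)%N -> branch n < branch n.+1.
Proof.
rewrite /branch => ng; case: (ltnP n g) => h.
  by rewrite ltnW // ltrN2; apply: (bp_lt a1 incr_a); lia.
case: (leqP n g) => h'.
  have -> : n = g by lia.
  by rewrite subnn oppr0; apply: (@bp_lt _ _ _ a1 incr_a 0); lia.
by apply: (bp_lt a1 incr_a); lia.
Qed.

Lemma branch_ge0 n : (g <= n)%N -> (n <= g.*2)%N -> 0 <= branch n.
Proof.
rewrite /branch => gn n2; case: (leqP n g) => h; last by apply: (bp_ge0 a1 incr_a); lia.
by rewrite (_ : (g - n = 0)%N) /= ?oppr0 //; lia.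
Qed.

Lemma branch_le0 n : (n <= g)%N -> branch n <= 0.
Proof.
by rewrite /branch => ->; rewrite oppr_le0; apply: (bp_ge0 a1 incr_a); lia.
Qed.

Lemma branch_side n : (n < g.*2)%N -> 0 <= branch n \/ branch n.+1 <= 0.
Proof.
move=> n2; case: (leqP g n) => h; [left|right].
  by apply: branch_ge0 => //; lia.
exact: branch_le0.
Qed.

Definition branch_integral (j n : nat) : R :=
  signed_integral g a j (branch n) (branch n.+1).

Lemma branch_integralE j n : (n < g.*2)%N ->
  branch_integral j n =
  if (n < g)%N then (-1) ^+ j * abs_integral g a j (bp a (g - n.+1)) (bp a (g - n))
  else abs_integral g a j (bp a (n - g)) (bp a (n.+1 - g)).
Proof.
move=> n2; rewrite /branch_integral /signed_integral; case: (ltnP n g) => h.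
  have bn : branch n < 0.
    have b0 : 0 < bp a (g - n) by apply: (@bp_lt _ _ _ a1 incr_a 0); lia.
    by rewrite /branch (ltnW h); lra.
  by rewrite leNgt bn /= /branch (ltnW h) h !opprK.
rewrite branch_ge0 //; last lia.
congr abs_integral; rewrite /branch; last by rewrite ifF //; lia.
case: leqP => h' //; rewrite (_ : n = g); last lia.
by rewrite subnn /= oppr0.
Qed.

Lemma Iint_branch j k : (k < g)%N -> Iint g a j k = branch_integral j k.*2.
Proof.
move=> kg; rewrite branch_integralE; last lia.
rewrite /Iint; case: ifP => h.
  by congr (_ * abs_integral _ _ _ (bp _ _) (bp _ _)); lia.
by congr (abs_integral _ _ _ (bp _ _) (bp _ _)); lia.
Qed.

(** The branch points are symmetric about 0, and so is [|f|]. *)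
Lemma branch_integral_sym j n : (n < g.*2)%N ->
  branch_integral j n = (-1) ^+ j * branch_integral j (g.*2.-1 - n).
Proof.
move=> n2; rewrite !branch_integralE //; last lia.
case: ifP => h; [rewrite ifF; last lia|rewrite ifT; last lia].
  rewrite (_ : g.*2.-1 - n - g = g - n.+1)%N; last lia.
  by rewrite (_ : (g.*2.-1 - n).+1 - g = g - n)%N; last lia.
rewrite mulrA -exprMn mulrNN mulr1 expr1n mul1r.
rewrite (_ : g - (g.*2.-1 - n).+1 = n - g)%N; last lia.
by rewrite (_ : g - (g.*2.-1 - n) = n.+1 - g)%N; last lia.
Qed.

End Branch.

Section RowsColumns.
Variables (R : realType) (g : nat) (a : nat -> R) (P : nat -> rect R).
Variables (Phi : Cplx R -> one_point_compactification (Cplx R * Cplx R)) (c : R).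
Local Notation C := (Cplx R).
Local Notation mu := (@lebesgue_measure R).
Hypothesis g2 : (2 <= g)%N.
Hypothesis a1 : 1 < a 1%N.
Hypothesis incr_a : forall j : nat, (1 <= j)%N -> (j.+1 < g)%N -> a j < a j.+1.
Hypothesis shP : polygon_shape g P.
Hypothesis c0 : 0 < c.
Hypothesis bi : biholomorphic_identification g a P Phi c.
Hypothesis mp : marked_points g a P Phi.

Local Notation branch := (branch g a).
Local Notation branch_integral := (branch_integral g a).

Lemma center_branch m : (m < nchain g)%N ->
  Phi (Defs.center (chain g P m)) = Some (toC (branch m.+1), 0).
Proof.
case: mp => h0 hP hQ _ _; rewrite /nchain /chain => mg; case: ifP => h.
  rewrite hQ; last lia.
  rewrite /branch ifT; last lia.
  rewrite (_ : g.-1 - m = g - m.+1)%N; last lia.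
  by rewrite -(rmorphN (@toC R)).
case: (posnP (m - g.-1)) => h'.
  rewrite h' h0 /branch ifT; last lia.
  by rewrite (_ : g - m.+1 = 0)%N /= ?oppr0 //; lia.
rewrite hP; last lia.
rewrite /branch ifF; last lia.
by rewrite (_ : m - g.-1 = m.+1 - g)%N //; lia.
Qed.

(** What [line_periods] says about a closed curve in the direction [d] whose half
    leads from the [n]-th branch point to the next one. *)
Definition half_period_line (n : nat) (d : C) (ga : Defs.path R) : Prop :=
  exists S T (x : R -> R),
  [/\ S < T, continuous x,
      forall t, S < t < T -> branch n < x t < branch n.+1,
      forall j, (\int[mu]_(t in `[S, T]) (x t ^+ j) = c * branch_integral j n)%R
    & forall (r : nat) (th : oneform R) (B : 'I_r -> C),
      (forall p v, plane_curve (fz g a) p -> tangent (fz g a) p v ->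
        pairing (form_zw th p) v =
        \sum_j B j * (p.1 ^+ j * pairing (du_over_v (fz g a) p) v)) ->
      path_integral g th ga = \sum_j B j * (2 * d * toC (branch_integral j n))].

Lemma eq_of_isolated s t : polygon g P s -> polygon g P t -> Phi s = Phi t ->
  (forall r, ~ glue_step g P s r /\ ~ glue_step g P r s) -> s = t.
Proof.
move=> ps pt e iso; have [_ _ /(_ s t ps pt)[/(_ e) gl _] _] := bi.
by rewrite (glued_isolated gl iso).
Qed.

(** The first row has one rectangle: the midpoint of its left side replaces the
    missing center. *)
Lemma row_periods k : (k < g)%N -> half_period_line k.*2 1 (alpha g P Phi k).
Proof.
move=> kg; rewrite /half_period_line /alpha row_rightE //.
have [-> _] := row_leftE g2 shP kg.
rewrite /row_right /ymid chain_even //=.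
set y := (rowY g P k + rowY g P k.+1) / 2.
have hy : rowY g P k < y < rowY g P k.+1 by have := rowY_lt g2 shP kg; rewrite /y; lra.
have hX := colX_lt g2 shP kg.
pose L t : C := mkC t y.
pose S := if k is 0 then colX g P 0 else (colX g P k.-1 + colX g P k) / 2.
pose T := (colX g P k + colX g P k.+1) / 2.
have hS : [/\ colX g P k.-1 <= S, S < T & colX g P k.+1 - colX g P k.-1 = 2 * (T - S)].
  rewrite /S /T; case: k kg hX {hy y L S T} => [|k] kg hX /=; first by split; lra.
  by have := colX_lt g2 shP (ltnW kg); split; lra.
case: hS => sS ST es.
have PS : Phi (L S) = Some (toC (branch k.*2), 0).
  rewrite /L /S; case: k kg {hX hy L S T sS ST es} @y => [|k] kg y.
    case: mp => _ _ _ _; rewrite (_ : Q P g.-1 = chain g P 0); last first.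
      by rewrite /chain subn0 ifT //; lia.
    rewrite /ymid (@chain_even _ _ _ g2 shP 0) //= => ->.
    by rewrite /branch /= subn0 -(rmorphN (@toC R)).
  have := @center_branch k.*2.+1; rewrite /nchain => /(_ ltac:(lia)).
  by rewrite chain_odd //= /Defs.center /xmid /ymid /=.
have PT : Phi (L T) = Some (toC (branch k.*2.+1), 0).
  have := @center_branch k.*2; rewrite /nchain => /(_ ltac:(lia)).
  by rewrite chain_even.
have pol t : colX g P k.-1 <= t <= colX g P k.+1 -> polygon g P (L t).
  by move=> ht; apply: row_polygon kg _ ht => //; case/andP: hy => *; rewrite !ltW.
have hL h t : L (h + t) = toC h * 1 + L t.
  by rewrite mulr1 /L /toC /mkC; congr (_ +i* _); rewrite /= add0r.
have injL t t' : colX g P k.-1 < t < colX g P k.+1 -> colX g P k.-1 <= t' <= colX g P k.+1 ->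
    Phi (L t) = Phi (L t') -> t = t'.
  move=> ht ht' e; have ht2 : colX g P k.-1 <= t <= colX g P k.+1 by lra.
  by case: (eq_of_isolated (pol t ht2) (pol t' ht') e (fun r => row_isolated g2 shP r kg hy ht)).
have Te : T <= colX g P k.+1 by rewrite /T; lra.
have n2 : (k.*2 < g.*2)%N by lia.
have [x [cx hx integ per]] := line_periods g2 a1 incr_a c0 bi hL (expr1n _ 2) (normr1 R)
  (fun t ht => conj (pol t ht) (row_not_vertex g2 shP kg hy)) injL
  sS ST Te es (branch_lt g2 a1 incr_a n2) (branch_side g2 a1 incr_a n2) PS PT.
by exists S, T, x; split.
Qed.

(** The last column has one rectangle: the midpoint of its upper side replaces
    the missing center. *)
Lemma column_periods k : (k < g)%N -> half_period_line k.*2.+1 'i (beta g P Phi k).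
Proof.
move=> kg; rewrite /half_period_line /beta col_topE //.
have [-> _] := col_bottomE g2 shP kg.
rewrite /col_bottom /xmid chain_even //=.
set x0 := (colX g P k + colX g P k.+1) / 2.
have hx0 : colX g P k < x0 < colX g P k.+1 by have := colX_lt g2 shP kg; rewrite /x0; lra.
have hY := rowY_lt g2 shP kg.
pose L t : C := mkC x0 t.
pose S := (rowY g P k + rowY g P k.+1) / 2.
pose T := if (k.+1 < g)%N then (rowY g P k.+1 + rowY g P k.+2) / 2 else rowY g P g.
have hT : [/\ S < T, T <= rowY g P (minn k.+2 g)
    & rowY g P (minn k.+2 g) - rowY g P k = 2 * (T - S)].
  rewrite /S /T; case: ifP => k1.
    rewrite (_ : minn k.+2 g = k.+2); last lia.
    by have := rowY_lt g2 shP k1; split; lra.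
  rewrite (_ : minn k.+2 g = g); last lia.
  rewrite (_ : g = k.+1) in hY *; last lia.
  by split; lra.
case: hT => ST Te es.
have PS : Phi (L S) = Some (toC (branch k.*2.+1), 0).
  have := @center_branch k.*2; rewrite /nchain => /(_ ltac:(lia)).
  by rewrite chain_even.
have PT : Phi (L T) = Some (toC (branch k.*2.+2), 0).
  rewrite /L /T; case: ifP => k1.
    have := @center_branch k.*2.+1; rewrite /nchain => /(_ ltac:(lia)).
    by rewrite chain_odd.
  case: mp => _ _ _ + _; rewrite (_ : P g.-1 = chain g P k.*2); last first.
    by rewrite /chain ifF; [congr P|]; lia.
  rewrite /xmid chain_even //= (_ : k.+1 = g); last lia.
  rewrite /x0 (_ : k.+1 = g); last lia.
  move=> ->; rewrite /branch ifF; last lia.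
  by rewrite (_ : k.*2.+2 - g = g)%N //; lia.
have pol t : rowY g P k <= t <= rowY g P (minn k.+2 g) -> polygon g P (L t).
  by move=> ht; apply: col_polygon kg _ ht => //; case/andP: hx0 => *; rewrite !ltW.
have hL h t : L (h + t) = toC h * 'i + L t.
  rewrite -complexiE /L /toC /mkC; apply/eqP; rewrite eq_complex /=.
  by apply/andP; split; apply/eqP; ring.
have injL t t' : rowY g P k < t < rowY g P (minn k.+2 g) ->
    rowY g P k <= t' <= rowY g P (minn k.+2 g) -> Phi (L t) = Phi (L t') -> t = t'.
  move=> ht ht' e; have ht2 : rowY g P k <= t <= rowY g P (minn k.+2 g) by lra.
  by case: (eq_of_isolated (pol t ht2) (pol t' ht') e (fun r => col_isolated g2 shP r kg hx0 ht)).
have sS : rowY g P k <= S by rewrite /S; lra.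
have n2 : (k.*2.+1 < g.*2)%N by lia.
have i2 : ('i : C) ^+ 2 = toC (- 1) by rewrite sqrCi; exact/esym/(rmorphN1 (@toC R)).
have [x [cx hx integ per]] := line_periods g2 a1 incr_a c0 bi hL i2 (normrN1 R)
  (fun t ht => conj (pol t ht) (col_not_vertex g2 shP kg hx0)) injL
  sS ST Te es (branch_lt g2 a1 incr_a n2) (branch_side g2 a1 incr_a n2) PS PT.
by exists S, T, x; split.
Qed.

End RowsColumns.

(** * The period matrices *)

Section Signs.
Variable R : realType.
Local Notation C := (Cplx R).

Lemma det_Mmx (g : nat) : \det (Mmx R g) = \prod_(j < g) (-1) ^+ j.
Proof.
rewrite det_trig; first by apply: eq_bigr => j _; rewrite mxE eqxx.
apply/is_trig_mxP => j k jk; rewrite mxE.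
by rewrite (_ : (j == k) = false) //; apply/negbTE; rewrite neq_ltn jk.
Qed.

(** Expanding along the last row leaves the same matrix of smaller size. *)
Lemma det_Nmx (g : nat) : \det (Nmx R g) = \prod_(j < g) (-1) ^+ j.
Proof.
elim: g => [|g IH]; first by rewrite det_mx00 big_ord0.
rewrite big_ord_recr /= -IH (expand_det_row _ ord_max) (bigD1 ord0) //= big1 ?addr0.
  rewrite mxE /= addn0 ltnSn subnn subn0 /= expr0 mul1r /cofactor /= addn0 mulrC.
  congr (\det _ * _); apply/matrixP => i j; rewrite !mxE /= /bump (leqNgt g i) ltn_ord add0n /=.
  rewrite add1n addnS ltnS; case: ifP => // h.
  by congr (_ ^+ _); lia.
move=> j j0; rewrite mxE /= ltnNge.
by rewrite (_ : (g < g + j)%N) ?mul0r // -[ltnLHS]addn0 ltn_add2l lt0n.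
Qed.

(** Both determinants are the sign of the reversal of [g] elements. *)
Lemma det_MN (g : nat) : \det (Mmx R g) * \det (Nmx R g) = 1.
Proof.
rewrite det_Mmx det_Nmx -big_split big1 // => j _ /=.
by rewrite -exprD addnn -mul2n exprM sqrrN !expr1n.
Qed.

End Signs.

Section Matrices.
Variables (R : realType) (g : nat) (a : nat -> R) (P : nat -> rect R).
Variables (Phi : Cplx R -> one_point_compactification (Cplx R * Cplx R)) (c : R).
Local Notation C := (Cplx R).
Local Notation mu := (@lebesgue_measure R).
Hypothesis g2 : (2 <= g)%N.
Hypothesis a1 : 1 < a 1%N.
Hypothesis incr_a : forall j : nat, (1 <= j)%N -> (j.+1 < g)%N -> a j < a j.+1.
Hypothesis shP : polygon_shape g P.
Hypothesis c0 : 0 < c.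
Hypothesis bi : biholomorphic_identification g a P Phi c.
Hypothesis mp : marked_points g a P Phi.
Local Notation branch := (branch g a).
Local Notation branch_integral := (branch_integral g a).

Definition realPi0 : 'M[R]_g := \matrix_(j, k) Iint g a j k.

Lemma Pi0E : Pi0 g a = map_mx (@toC R) realPi0.
Proof. by apply/matrixP => j k; rewrite !mxE. Qed.

(** A polynomial of degree less than [g] whose weighted integrals over the [g]
    intervals [branch 2k, branch 2k+1] vanish has a root in each of them. *)
Lemma realPi0_unit : realPi0 \in unitmx.
Proof.
rewrite -row_free_unit -kermx_eq0; apply/rowV0P => r /sub_kermxP rA.
pose p : {poly R} := \poly_(i < g) (if insub i is Some j then r 0 j else 0).
have root_in (k : 'I_g) : exists y, branch k.*2 < y < branch k.*2.+1 /\ root p y.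
  have [S [T [x [ST cx hx integ _]]]] := row_periods g2 a1 incr_a shP c0 bi mp (ltn_ord k).
  have pE t : p.[x t] = \sum_(j < g) r 0 j * x t ^+ j.
    by rewrite horner_poly; apply: eq_bigr => j _; rewrite valK.
  have cxj (j : 'I_g) : continuous (fun t => x t ^+ j) by exact: expr_comp_continuous.
  have int0 : (\int[mu]_(t in `[S, T]) p.[x t] = 0)%R.
    under eq_Rintegral do rewrite pE.
    rewrite (Rintegral_lincomb _ (fun j => r 0 j) S T cxj).
    under eq_bigr do rewrite integ mulrCA.
    rewrite -mulr_sumr; have := congr1 (fun M : 'rV[R]_g => M 0 k) rA; rewrite !mxE => E.
    rewrite [X in _ * X](_ : _ = 0) ?mulr0 // -[RHS]E.
    by apply: eq_bigr => j _; rewrite mxE Iint_branch.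
  have cpx : continuous (fun t => p.[x t]).
    move=> t; apply: (@continuous_comp _ _ _ x (horner p)); first exact: cx.
    exact: continuous_horner.
  have [t /hx ht pt] := Rintegral_zero cpx ST int0.
  by exists (x t); split=> //; apply/rootP.
have [y hy] := choice root_in.
have mono (i j : 'I_g) : (i < j)%N -> y i < y j.
  move=> ij; have [/andP[_ h1] _] := hy i; have [/andP[h2 _] _] := hy j.
  rewrite (lt_trans h1) // (le_lt_trans _ h2) //.
  have : (i.*2.+1 <= j.*2)%N by lia.
  have : (j.*2 <= g.*2)%N by have := ltn_ord j; lia.
  elim: (j.*2) => [|n IH]; first by lia.
  move=> ng; rewrite leq_eqVlt => /predU1P[-> //|h].
  by rewrite (le_trans (IH (ltnW ng) h)) // ltW // branch_lt.
have us : uniq [seq y k | k <- enum 'I_g].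
  rewrite map_inj_uniq ?enum_uniq // => i j e.
  by apply/val_inj; case: (ssrnat.ltngtP i j) => // /mono; rewrite e ltxx.
have rs : all (root p) [seq y k | k <- enum 'I_g].
  by apply/allP => _ /mapP[k _ ->]; have [] := hy k.
have p0 : p = 0.
  apply/eqP; apply: contraT => nz; have := max_poly_roots nz rs us.
  rewrite size_map size_enum_ord => h.
  by have := leq_trans h (size_poly _ _); rewrite ltnn.
apply/rowP => j; rewrite mxE; have := congr1 (fun q : {poly R} => q`_j) p0.
by rewrite coef_poly ltn_ord valK coef0.
Qed.

Lemma Pi0_unit : Pi0 g a \in unitmx.
Proof. by rewrite Pi0E map_unitmx realPi0_unit. Qed.

Variable om : 'I_g -> oneform R.
Variable B : 'M[C]_g.
Hypothesis omE : forall p v, plane_curve (fz g a) p -> tangent (fz g a) p v ->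
  forall k, pairing (form_zw (om k) p) v =
    \sum_j B k j * (p.1 ^+ j * pairing (du_over_v (fz g a) p) v).

Lemma alpha_periods :
  period_mx g om (alpha_cycle g P Phi) = B *m (2 *: Pi0 g a).
Proof.
apply/matrixP => j k; rewrite !mxE /cycle_integral big_seq1 /= mulr1z mul1r.
have [S [T [x [_ _ _ _ per]]]] := row_periods g2 a1 incr_a shP c0 bi mp (ltn_ord k).
rewrite (per g (om j) (fun l => B j l)) => [|p v cp tp]; last exact: omE.
by apply: eq_bigr => l _; rewrite !mxE Iint_branch // mulr1.
Qed.

(** Reversing the order of the columns of [Pi0] turns the intervals used by the
    rows of the polygon into those used by its columns, up to the signs in [M];
    the rest of [N] is the change from [beta] to [gamma]. *)
Lemma MPi0NE (j k : 'I_g) : (Mmx R g *m Pi0 g a *m Nmx R g) j k =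
  \sum_(l < g | (k <= l)%N) (-1) ^+ (l - k) * toC (branch_integral j l.*2.+1).
Proof.
rewrite -mulmxA mxE (bigD1 j) //= big1 ?addr0; last first.
  by move=> i ij; rewrite mxE eq_sym (negPf ij) mul0r.
rewrite !mxE eqxx mulr1n mulr_sumr.
rewrite (reindex_inj rev_ord_inj) /= [RHS]big_mkcond /=; apply: eq_bigr => l _.
rewrite !mxE /= (Iint_branch g2 a1 incr_a); last lia.
have lg := ltn_ord l; have kg := ltn_ord k.
rewrite (_ : (g - l.+1 + k < g)%N = (k <= l)%N); last by apply/idP/idP; lia.
case: ifP => kl; last by rewrite !mulr0.
rewrite (_ : g.-1 - (g - l.+1) - k = l - k)%N; last lia.
rewrite (branch_integral_sym g2 a1 incr_a j (n := l.*2.+1)); last lia.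
rewrite (_ : (g - l.+1).*2 = g.*2.-1 - l.*2.+1)%N; last lia.
move: (branch_integral _ _) => J.
have -> : toC ((-1) ^+ j * J) = (-1) ^+ j * toC J.
  apply: etrans (rmorphM (@toC R) _ _) _; congr (_ * _).
  exact: (rmorph_sign (@toC R)).
ring.
Qed.

Lemma gamma_periods :
  period_mx g om (gamma_cycle g P Phi) =
  B *m ((2 * 'i) *: (Mmx R g *m Pi0 g a *m Nmx R g)).
Proof.
apply/matrixP => j k; rewrite !mxE /cycle_integral /gamma_cycle big_map.
rewrite -/(index_iota k g).
rewrite (eq_big_nat _ _ (F2 := fun l => \sum_(m < g) B j m * (2 * 'i) *
    ((-1) ^+ (l - k) * toC (branch_integral m l.*2.+1)))); last first.
  move=> l /andP[kl lg] /=.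
  have [S [T [x [_ _ _ _ per]]]] := column_periods g2 a1 incr_a shP c0 bi mp lg.
  rewrite (per g (om j) (fun l => B j l)) => [|p v cp tp]; last exact: omE.
  rewrite rmorph_sign mulr_sumr; apply: eq_bigr => m _; ring.
rewrite exchange_big /=; apply: eq_bigr => m _.
rewrite -mulr_sumr -mulrA [in RHS]mxE MPi0NE; congr (_ * (_ * _)).
rewrite big_geq_mkord.
by [].
Qed.

End Matrices.

Theorem theorem3p5 (R : realType) (g : nat) (a : nat -> R)
    (P : nat -> rect R) (Phi : Cplx R -> one_point_compactification (Cplx R * Cplx R)) (c : R)
    (om : 'I_g -> oneform R) :
  (2 <= g)%N ->
  1 < a 1%N -> (forall j : nat, (1 <= j)%N -> (j.+1 < g)%N -> a j < a j.+1) ->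
  polygon_shape g P ->
  0 < c ->
  biholomorphic_identification g a P Phi c ->
  marked_points g a P Phi ->
  holomorphic_basis g a om ->
  let A := period_mx g om (alpha_cycle g P Phi) in
  let C := period_mx g om (gamma_cycle g P Phi) in
  let Pi := invmx A *m C in
  [/\ A \in unitmx,
      Pi0 g a \in unitmx,
      Pi = 'i *: (invmx (Pi0 g a) *m Mmx R g *m Pi0 g a *m Nmx R g),
      map_mx (@reC R) Pi = 0
    & \det Pi = 'i ^+ g].
Proof.
move=> g2 a1 incr_a shP c0 bi mp basis A D Pi.
have [B uB omE] := basis_zform g2 a1 incr_a basis.
have uPi0 : Pi0 g a \in unitmx := Pi0_unit g2 a1 incr_a shP c0 bi mp.
have AE : A = B *m (2 *: Pi0 g a) := alpha_periods g2 a1 incr_a shP c0 bi mp omE.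
have DE : D = B *m ((2 * 'i) *: (Mmx R g *m Pi0 g a *m Nmx R g)) :=
  gamma_periods g2 a1 incr_a shP c0 bi mp omE.
have u2 : (2 : Cplx R) \is a GRing.unit by rewrite unitfE pnatr_eq0.
have uA : A \in unitmx by rewrite AE unitmx_mul uB unitmxZ.
set X := invmx (Pi0 g a) *m Mmx R g *m Pi0 g a *m Nmx R g.
have PiE : Pi = 'i *: X.
  rewrite /Pi (_ : D = A *m ('i *: X)); first by rewrite mulKmx.
  rewrite DE AE -[RHS]mulmxA; congr (_ *m _).
  by rewrite -scalemxAl -scalemxAr scalerA /X -!mulmxA mulKVmx.
have realX : exists Y : 'M[R]_g, X = map_mx (@toC R) Y.
  pose M' : 'M[R]_g := \matrix_(j, k) ((-1) ^+ j *+ (j == k)).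
  pose N' : 'M[R]_g := \matrix_(j, k) if (j + k < g)%N then (-1) ^+ (g.-1 - j - k) else 0.
  have ME : Mmx R g = map_mx (@toC R) M'.
    apply/matrixP => j k; rewrite !mxE; case: (j == k); rewrite ?mulr1n ?mulr0n.
      exact/esym/(rmorph_sign (@toC R)).
    exact/esym/(rmorph0 (@toC R)).
  have NE : Nmx R g = map_mx (@toC R) N'.
    apply/matrixP => j k; rewrite !mxE; case: ifP => _; last exact/esym/(rmorph0 (@toC R)).
    exact/esym/(rmorph_sign (@toC R)).
  exists (invmx (realPi0 g a) *m M' *m realPi0 g a *m N').
  by rewrite /X ME NE Pi0E !(map_mxM (@toC R)) (map_invmx (@toC R)).
split=> //.
  have [Y XE] := realX; rewrite PiE XE; apply/matrixP => j k; rewrite !mxE.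
  by rewrite /reC /toC -complexiE /=; ring.
have perm4 (p q r t : Cplx R) : p * q * r * t = (q * t) * (p * r) by ring.
have d0 : \det (Pi0 g a) != 0 by rewrite -unitfE -unitmxE.
rewrite PiE detZ /X !det_mulmx det_inv.
transitivity ('i ^+ g * ((\det (Mmx R g) * \det (Nmx R g)) *
                         ((\det (Pi0 g a))^-1 * \det (Pi0 g a)))).
  by congr (_ * _); exact: perm4.
by rewrite det_MN mulVf // !mulr1.
Qed.
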